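(* Let $d\ge 1$, let $\mathbf{X}=(X_1,\ldots,X_d)$ be a random vector in $\mathbb{R}^d$ with law $\mu$, let $f:\mathbb{R}^d\to\mathbb{R}$ be differentiable, and fix $j\in\{1,\ldots,d\}$. Assume: (A1) $X_1,\ldots,X_d$ are independent; (A2) $\mathbb{E}[f(\mathbf{X})^2]<+\infty$; (A3) $\mathbb{E}\left[\left(\frac{\partial f}{\partial x_j}(\mathbf{X})\right)^2\right]<+\infty$; (A4) the law $\mu_j$ of $X_j$ is a Boltzmann probability measure on $\mathbb{R}$. Let $\rho_j$ be the density of $X_j$ (of the form $c\,e^{-v}$ with $v:\mathbb{R}\to\mathbb{R}$ continuous and $c>0$), let $F_j$ be the cumulative distribution function of $X_j$, and set $$C_1=\sup_{x\in\mathbb{R}}\frac{\min\left(F_j(x),\,1-F_j(x)\right)}{\rho_j(x)}\in[0,+\infty],\qquad C(\mu_j)=4C_1^2 .$$ Then $$D_j^{tot}\le C(\mu_j)\,\nu_j ,$$ where $\nu_j=\int\left(\frac{\partial f(\mathbf{x})}{\partial x_j}\right)^2 d\mu(\mathbf{x})$ and $D_j^{tot}$ is the (unnormalized) total Sobol' index of $X_j$, i.e. the sum of the variances of all terms involving $X_j$ in the Hoeffding decomposition of $f(\mathbf{X})$. (The inequality is read in $[0,+\infty]$ with the convention $\infty\cdot 0=0$.)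
   Context: **Boltzmann measure.** A probability measure $\delta$ on $\mathbb{R}$ is a Boltzmann measure if it is absolutely continuous with respect to Lebesgue measure with density $\rho(x)=c\exp[-v(x)]$ for all $x\in\mathbb{R}$, where $v:\mathbb{R}\to\mathbb{R}$ is a continuous function and $c>0$ is a normalizing constant. **Hoeffding decomposition.** When $X_1,\ldots,X_d$ are independent and $\mathbb{E}[f(\mathbf{X})^2]<\infty$, one has $f(\mathbf{X})=\sum_{u\subseteq\{1,\ldots,d\}}f_u(\mathbf{X}_u)$, where $\mathbf{X}_u=(X_i)_{i\in u}$, $f_\emptyset=f_0=\mathbb{E}[f(\mathbf{X})]$ and, recursively, $f_u(\mathbf{X}_u)=\mathbb{E}[f(\mathbf{X})\mid\mathbf{X}_u]-\sum_{v\subsetneq u}f_v(\mathbf{X}_v)$. **Total Sobol' index (unnormalized).** $D_j^{tot}=\sum_{v\subseteq\{1,\ldots,d\},\ v\ni j}\mathbb{E}\left[f_v(\mathbf{X}_v)^2\right]$. **Derivative-based global sensitivity measure (DGSM).** $\nu_j=\mathbb{E}\left[\left(\frac{\partial f}{\partial x_j}(\mathbf{X})\right)^2\right]$. The quantity $C_1$ is called the Cheeger constant of $\mu_j$. *)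

(* Defs.v *)
From HB Require Import structures.
From mathcomp Require Import all_boot all_order all_algebra.
From mathcomp Require Import all_classical all_reals all_analysis.

Set Implicit Arguments.
Unset Strict Implicit.
Unset Printing Implicit Defensive.

Import Order.TTheory GRing.Theory Num.Theory.
Import numFieldNormedType.Exports.

Local Open Scope classical_set_scope.
Local Open Scope ring_scope.

Section GlobalSensitivity.
Context (disp : measure_display) (T : measurableType disp) (R : realType)
  (P : probability T R) (d : nat).
Implicit Types (X : 'I_d -> {RV P >-> R}) (u : {set 'I_d}) (j : 'I_d).

Definition random_vector X (w : T) : 'rV[R]_d := \row_i X i w.

Definition mutually_independent X : Prop :=
  forall (u : {set 'I_d}) (A : 'I_d -> set R),
    (forall i, measurable (A i)) ->
    P (\bigcap_(i in [set` u]) X i @^-1` A i)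
    = (\prod_(i in u) P (X i @^-1` A i))%E.

(* Generators of the sigma-algebra sigma(X_u), X_u = (X_i)_{i in u}. *)
Definition coordinate_events X u : set (set T) :=
  \bigcup_(i in [set` u]) preimage_set_system setT (X i) measurable.

(* g is a version of E[Y | sigma(G)]. *)
Definition cond_expectation (G : set (set T)) (Y g : T -> R) : Prop :=
  [/\ measurable_fun [set: g_sigma_algebraType G]
        (g : g_sigma_algebraType G -> R),
      P.-integrable setT (EFin \o g) &
      forall A, <<s G >> A ->
        (\int[P]_(w in A) (g w)%:E = \int[P]_(w in A) (Y w)%:E)%E].

(* F u is the random variable f_u(X_u) of the Hoeffding decomposition of
   Y = f(X). Conditional expectations are unique only up to P-null sets, so
   this is a relation: each recursion step may use any version. *)
Definition hoeffding_components X (Y : T -> R) (F : {set 'I_d} -> T -> R) : Prop :=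
  (forall w, (F finset.set0 w)%:E = 'E_P[Y]%E) /\
  (forall u, u != finset.set0 ->
     exists2 g : T -> R, cond_expectation (coordinate_events X u) Y g &
       forall w, F u w = g w - \sum_(v : {set 'I_d} | v \proper u) F v w).

Definition total_sobol (F : {set 'I_d} -> T -> R) j : \bar R :=
  (\sum_(v : {set 'I_d} | j \in v) 'E_P[fun w => (F v w ^+ 2)%R])%E.

Definition partial (f : 'rV[R]_d -> R) j (x : 'rV[R]_d) : R :=
  'D_(delta_mx 0 j) f x.

Definition dgsm X (f : 'rV[R]_d -> R) j : \bar R :=
  ('E_P[fun w => (partial f j (random_vector X w) ^+ 2)%R])%E.

Definition boltzmann_density (mu : set R -> \bar R) (rho : R -> R) : Prop :=
  (exists (v : R -> R) (c : R),
     [/\ continuous v, 0 < c & forall x, rho x = c * expR (- v x)]) /\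
  (forall A : set R, measurable A ->
     mu A = (\int[lebesgue_measure]_(x in A) (rho x)%:E)%E).

Definition cheeger_constant (Z : {RV P >-> R}) (rho : R -> R) : \bar R :=
  ereal_sup (range (fun x : R =>
    Order.min (cdf Z x) (1 - cdf Z x) * ((rho x)^-1)%:E))%E.

End GlobalSensitivity.

(* Main.v *)
(* Let mu be the law of X and E_u f the integral of f over the coordinates outside
   u, which is a version of E[f(X) | X_u].  By independence mu x mu is invariant
   under exchanging any set of coordinates of two copies of X, whence
   <E_u f, E_w f> = <E_(u cap w) f, E_w f>; by induction the Hoeffding components are
   orthogonal, and D_j^tot = |f|^2 - |E_(-j) f|^2, the mean over x_(-j) of the variance
   of the slice q of f in the direction j.

   Each variance is at most the integral of h^2, h = q - q(m), where m is a median
   of mu_j.  As h^2(x) is at most the integral of 2 |h q'| between m and x, Fubini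
   bounds the integral of h^2 by that of 2 |h q'| min(F_j, 1 - F_j), hence by
   2 C_1 times the mu_j-integral of |h q'|, and AM-GM absorbs h.  If C_1 is infinite
   and q' vanishes almost everywhere, the same estimate gives h = 0. *)

Require Import Defs.
From HB Require Import structures.
From mathcomp Require Import all_boot all_order all_algebra.
From mathcomp Require Import all_classical all_reals all_analysis.
From mathcomp Require Import measurable_realfun ring lra.

Set Implicit Arguments.
Unset Strict Implicit.
Unset Printing Implicit Defensive.

Import Order.TTheory GRing.Theory Num.Theory.
Import numFieldNormedType.Exports.

Local Open Scope classical_set_scope.
Local Open Scope ring_scope.

(** * Increments of everywhere differentiable functions *)

(** Slices of f are differentiable everywhere, but their derivatives may be discontinuous and not
    locally integrable. Increments are therefore only bounded above by the Lebesgue integral of the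
    absolute derivative, a value in [0, +oo]; this one-sided bound is all that Fubini needs. The
    base point is a median because the points separated from it by t form a half-line of mass at
    most the smaller of F_j(t) and 1 - F_j(t). The constant comes from 2 C_1 |h q'| <= h^2 / 2 + 2
    C_1^2 q'^2: moving half of the integral of h^2 to the left doubles 2 C_1^2 into 4 C_1^2. This
    requires that integral to be finite, which square integrability of f gives for almost every
    slice only. The Hoeffding components come from arbitrary versions, with no formula of their own.
    What is known is that their sums over the subsets of u are almost surely E_u f; orthogonality is
    extracted from these sums by finite combinatorics. *)

Lemma derivable_cvg_derive1 (R : realType) (f : R -> R) (x : R) :
  derivable f x 1 -> h^-1 *: (f (h + x) - f x) @[h --> 0^'] --> f^`()%classic x.
Proof.
rewrite derive1E /derive => /cvg_ex[l hl].
have hl' : h^-1 *: (f (h + x) - f x) @[h --> 0^'] --> l.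
  rewrite (_ : (fun h => _) = (fun h : R => h^-1 *: (f (h *: 1 + x) - f x)))//.
  by apply/funext => h /=; rewrite [h *: 1]mulr1.
by rewrite (cvg_lim _ hl).
Qed.

(** The gap between [M] and [|f' x|] is the tolerance in the limit of the difference quotients. The
    bound is anchored at [x]: two other points are not compared. *)
Lemma derivable_locally_lipschitz (R : realType) (f : R -> R) (x M : R) :
  derivable f x 1 -> `|f^`()%classic x| < M ->
  exists2 e, 0 < e & forall y, `|y - x| < e -> `|f y - f x| <= M * `|y - x|.
Proof.
move=> dfx fxM.
have := derivable_cvg_derive1 dfx => /cvgrPdist_lt /(_ (M - `|f^`()%classic x|)).
rewrite subr_gt0 => /(_ fxM).
move=> /nbhs_ballP[e /= e0 he]; exists e => // y yx.
have [->|yneqx] := eqVneq y x; first by rewrite !subrr normr0 mulr0.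
have h0 : y - x != 0 by rewrite subr_eq0.
have := he (y - x); rewrite /ball/= sub0r normrN => /(_ yx h0).
rewrite subrK => h.
have : `|(y - x)^-1 *: (f y - f x)| <= M.
  rewrite ltW// -(subrK (f^`()%classic x) (_ *: _)) (le_lt_trans (ler_normD _ _))//.
  by rewrite -ltrBrDr distrC.
by rewrite normrZ normfV mulrC ler_pdivrMr ?normr_gt0.
Qed.

(* A relation that holds locally on both sides of every point of [a, b] holds
   between a and b: take the supremum of the points reachable from a. *)
Lemma real_interval_chain (R : realType) (Q : R -> R -> Prop) (a b : R) :
  a <= b ->
  (forall x y z, x <= y -> y <= z -> Q x y -> Q y z -> Q x z) ->
  (forall x, a <= x <= b -> exists2 e, 0 < e &
    (forall y, x - e < y <= x -> Q y x) /\ (forall z, x <= z < x + e -> Q x z)) ->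
  Q a b.
Proof.
move=> ab Qtr Qloc.
pose S := [set x | a <= x <= b /\ Q a x].
have Sa : S a.
  split; first by rewrite lexx ab.
  have [e e0 [_ ]] := Qloc a ltac:(by rewrite lexx ab).
  by apply; rewrite lexx/= ltrDl.
have supS : has_sup S.
  by split; [exists a | exists b => x [/andP[]]].
have ac : a <= sup S by apply: ub_le_sup => //; case: supS.
have cb : sup S <= b by apply: ge_sup; [exists a | move=> x [/andP[]]].
have [e e0 [Ql Qr]] := Qloc (sup S) ltac:(by rewrite ac cb).
have [y [/andP[ay yb] Qay] yc] := sup_adherent e0 supS.
have yS : y <= sup S by apply: ub_le_sup; [case: supS|split => //; rewrite ay].
have Qac : Q a (sup S) by apply: (Qtr _ y) => //; apply: Ql; rewrite yc.
have [bc|cb'] := leP b (sup S).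
  by have -> : b = sup S by apply/eqP; rewrite eq_le bc cb.
(* A point strictly beyond [sup S], within reach of [Qr] and not past [b]: it lies in [S], a
   contradiction. *)
pose z := Num.min b (sup S + e / 2).
have cz : sup S < z by rewrite lt_min cb' ltrDl divr_gt0.
have zS : S z.
  split; first by rewrite (le_trans ac (ltW cz))/= ge_min lexx.
  apply: (Qtr _ (sup S)) => //; first exact: ltW.
  apply: Qr; rewrite (ltW cz)/= gt_min; apply/orP; right.
  by rewrite ltrD2l ltr_pdivrMr// ltr_pMr// ltr1n.
have : z <= sup S by apply: ub_le_sup => //; case: supS.
by rewrite leNgt cz.
Qed.

(** The derivative is the pointwise limit of the continuous difference quotients with step
    [1 / (n + 1)]. *)
Lemma measurable_derive1 (R : realType) (f : R -> R) :
  (forall x, derivable f x 1) -> measurable_fun [set: R] f^`()%classic.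
Proof.
move=> df.
have mf : measurable_fun [set: R] f.
  apply: continuous_measurable_fun => x.
  by apply: differentiable_continuous; exact/derivable1_diffP.
pose h n : R := n.+1%:R^-1.
apply: (@measurable_fun_cvg _ _ _ _
    (fun n x => (h n)^-1 * (f (h n + x) - f x))) => [n|x _].
  apply: measurable_funM => //; apply: measurable_funB => //.
  by apply: measurableT_comp => //; exact: measurable_funD.
apply: (cvg_comp _ _ _ (derivable_cvg_derive1 (df x))).
move=> A; rewrite /dnbhs/within/= => /nbhs_ballP[e /= e0 he].
near=> n.
apply: he => /=; last by rewrite invr_neq0.
rewrite /ball/= sub0r normrN ger0_norm ?invr_ge0//.
near: n; exact: near_infty_natSinv_lt (PosNum e0).
Unshelve. all: by end_near. Qed.

(* The derivative need not be continuous, nor even integrable, so that the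
   fundamental theorem of calculus of the library does not apply.  Cut [a, b]
   into the level sets E n of |f'|, thicken them to open sets U n, and majorize
   |f'| by g, which is locally bounded below by the slopes of f. *)
Lemma derive1_increment_le (R : realType) (f : R -> R) (a b : R) :
  (forall x, derivable f x 1) -> a <= b ->
  ((f b - f a)%:E <=
   \int[lebesgue_measure]_(t in `[a, b]) (`|f^`()%classic t|)%:E)%E.
Proof.
move=> df ab; pose mu : {measure set (measurableTypeR R) -> \bar R} := @lebesgue_measure R.
have mf' : measurable_fun [set: measurableTypeR R] f^`()%classic := measurable_derive1 df.
have mabs : measurable_fun [set: measurableTypeR R] (fun t => (`|f^`()%classic t|)%:E).
  by apply/measurable_EFinP; exact: measurableT_comp.
apply/lee_addgt0Pr => e e0.
(* Rounding [|f'|] up to a multiple of [eps] costs [eps * (b - a) <= e / 2]; the [+ 1] keeps the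
   denominator positive when [a = b]. *)
pose eps := e / (2 * (b - a + 1)).
have ba1 : 0 < b - a + 1 by rewrite ltr_wpDl ?subr_ge0.
have eps0 : 0 < eps by rewrite divr_gt0 ?mulr_gt0.
pose c n : R := n.+1%:R * eps.
have c0 n : 0 < c n by rewrite mulr_gt0.
pose E n := `[a, b]%classic `&` (fun t => `|f^`()%classic t|) @^-1` `[n%:R * eps, c n[%classic.
have mE n : measurable (E n : set (measurableTypeR R)).
  apply: measurableI => //; rewrite -[X in measurable X]setTI.
  by apply: (measurableT_comp (@normr_measurable R _) mf') => //.
have Eab n : E n `<=` `[a, b] by apply: subIsetl.
have muab : mu `[a, b]%classic = (b - a)%:E.
  rewrite [LHS](lebesgue_measure_itv `[a, b])/= lte_fin; case: ltgtP ab => // ->.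
  by rewrite subrr.
have muyz y z : y <= z -> mu `]y, z]%classic = (z - y)%:E.
  move=> yz; rewrite [LHS](lebesgue_measure_itv `]y, z])/= lte_fin.
  by case: ltgtP yz => // ->; rewrite subrr.
have muE n : (mu (E n) < +oo)%E.
  apply: (@le_lt_trans _ _ (mu `[a, b]%classic)); last by rewrite muab ltry.
  by rewrite le_measure ?inE//; exact: mE.
(* The excess of [U n], weighted by [c n], is at most [e / 2 / 2 ^ n.+1]; these sum to the other
   [e / 2]. *)
have /choice[U hU] : forall n, exists V : set R, [/\ open V, E n `<=` V &
    (mu (V `\` E n) < (e / 2 / (2 ^ n.+1)%:R / c n)%:E)%E].
  move=> n; apply: lebesgue_regularity_outer; [exact: mE|exact: muE|].
  by rewrite !divr_gt0.
have mU n : measurable (U n : set (measurableTypeR R)) by apply: open_measurable; case: (hU n).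
pose g x := (\sum_(0 <= n <oo) ((c n)%:E * (\1_(U n) x)%:E))%E.
have mg_ n : measurable_fun [set: measurableTypeR R] (fun x => (c n)%:E * (\1_(U n) x)%:E)%E.
  by apply/measurable_EFinP; apply: measurable_funM => //; exact: measurable_indic.
have g_ge0 n x : (0 <= (c n)%:E * (\1_(U n) x)%:E)%E.
  by rewrite -EFinM lee_fin mulr_ge0// ltW.
have mg : measurable_fun [set: measurableTypeR R] g.
  by apply: ge0_emeasurable_sum => // n x _ _; exact: g_ge0.
have g0 x : (0 <= g x)%E by apply: nneseries_ge0 => n _ _; exact: g_ge0.
have Ecover x : a <= x <= b -> exists n, E n x.
  move=> xab; exists (Num.truncn (`|f^`()%classic x| / eps)); split=> /=.
    by rewrite in_itv.
  rewrite in_itv/= /c -ler_pdivlMr// -ltr_pdivrMr//.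
  by apply: truncn_itv; rewrite divr_ge0// ltW.
have step1 : (\int[mu]_(t in `[a, b]) g t
    <= \int[mu]_(t in `[a, b]) (`|f^`()%classic t|)%:E + e%:E)%E.
  rewrite /g integral_nneseries//; last by move=> n; exact: (measurable_funTS (mg_ n)).
  apply: (@le_trans _ _ (\sum_(0 <= n <oo)
      ((c n)%:E * mu (E n) + (e / 2 / (2 ^ n.+1)%:R)%:E))%E).
    apply: lee_nneseries => [n _ _|n _].
      by apply: integral_ge0 => x _; exact: g_ge0.
    rewrite ge0_integralZl_EFin//; last 2 first.
    - by apply/measurable_EFinP; exact: measurable_indic.
    - exact: ltW.
    rewrite integral_indic//.
    have [_ EU UE] := hU n.
    apply: (@le_trans _ _ ((c n)%:E * (mu (E n) + mu (U n `\` E n)))%E).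
      rewrite lee_wpmul2l ?lee_fin ?(ltW (c0 n))//.
      rewrite -measureU//; last 2 first.
      - exact: measurableD.
      - by rewrite setDIK.
      by rewrite setDUK// le_measure ?inE//; exact: measurableI.
    rewrite ge0_muleDr// leeD2l//.
    rewrite -[leRHS](_ : ((c n)%:E * (e / 2 / (2 ^ n.+1)%:R / c n)%:E)%E = _).
      by rewrite lee_wpmul2l ?lee_fin ?(ltW (c0 n))// ltW.
    by rewrite -EFinM mulrC divfK// gt_eqF.
  apply: (le_trans (epsilon_trick _ _ _)) => [n||].
  - by rewrite mule_ge0// lee_fin ltW.
  - by rewrite ltW// divr_gt0.
  have -> : (e%:E = (e / 2)%:E + (e / 2)%:E)%E by rewrite -EFinD -splitr.
  rewrite addeA leeD2r//.
  apply: (@le_trans _ _ (\sum_(0 <= n <oo)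
      \int[mu]_(t in E n) ((`|f^`()%classic t|)%:E + eps%:E))%E).
    apply: lee_nneseries => [n _ _|n _].
      by rewrite mule_ge0// lee_fin ltW.
    rewrite -integral_cst//; apply: ge0_le_integral => //.
    - by move=> x _; rewrite lee_fin ltW.
    - by apply: measurable_funTS; exact: emeasurable_funD.
    - move=> x [_ /=]; rewrite in_itv/= => /andP[nf _].
      by rewrite lee_fin /c -natr1 mulrDl mul1r lerD2r.
  rewrite -ge0_integral_bigcup//; last 3 first.
  - by apply: measurable_funTS; exact: emeasurable_funD.
  - by move=> x _; rewrite adde_ge0// lee_fin// ltW.
  (* The level sets are disjoint: [n] is recovered as the integer part of [|f' x| / eps]. *)
  - apply/trivIsetP => i j _ _ ij; rewrite -subset0 => x [[_ /=] + [_ /=]].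
    rewrite !in_itv/= => i12 j12; have /eqP := ij; apply.
    have tr k : k%:R * eps <= `|f^`()%classic x| < c k ->
        Num.truncn (`|f^`()%classic x| / eps) = k.
      by move=> k12; apply: truncn_def; rewrite ler_pdivlMr// ltr_pdivrMr.
    by rewrite -(tr i)// (tr j).
  have -> : \bigcup_n E n = `[a, b]%classic.
    apply/seteqP; split=> [x [n _ [] //]|x /= xab].
    by have [n Ex] := Ecover x xab; exists n.
  rewrite ge0_integralD//; last 2 first.
  - exact: measurable_funTS.
  - by move=> x _; rewrite lee_fin ltW.
  rewrite leeD2l// integral_cst//= muab -EFinM lee_fin /eps.
  rewrite invfM mulrA mulrAC ler_pdivrMr// ler_wpM2l ?divr_ge0 ?(ltW e0)//.
  by rewrite lerDl.
apply: le_trans step1.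
apply: (@le_trans _ _ (\int[mu]_(t in `]a, b]) g t)%E); last first.
  apply: ge0_subset_integral => //; first exact: measurable_funTS.
  by move=> x /=; rewrite !in_itv/= => /andP[/ltW -> ->].
(* Half-open intervals concatenate without overlap, so the relation is transitive. *)
apply: (@real_interval_chain R (fun y z =>
  (f z - f y)%:E <= \int[mu]_(t in `]y, z]) g t)%E a b) => //.
  move=> x y z xy yz xQy yQz.
  rewrite (@itv_bndbnd_setU _ _ _ (BRight y))// ge0_integral_setU//.
  - by rewrite -(subrK (f y) (f z)) -addrA EFinD addeC; exact: leeD.
  - exact: measurable_funTS.
  - apply/disj_setPS => t /= [] /=; rewrite !in_itv/= => /andP[_ ty] /andP[yt _].
    by have := le_lt_trans ty yt; rewrite ltxx.
move=> x xab; have [n Enx] := Ecover x xab.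
have [oU EU _] := hU n.
have [e1 e10 he1] : exists2 e, 0 < e & forall y, `|y - x| < e -> `|f y - f x| <= c n * `|y - x|.
  apply: derivable_locally_lipschitz => //.
  by case: Enx => _ /=; rewrite in_itv/= => /andP[].
have /nbhs_ballP[e2 /= e20 he2] : nbhs x (U n) by apply: open_nbhs_nbhs; split=> //; exact: EU.
have key y z : y <= z -> `]y, z] `<=` U n -> f z - f y <= c n * (z - y) ->
    ((f z - f y)%:E <= \int[mu]_(t in `]y, z]) g t)%E.
  move=> yz yzU fyz.
  apply: (@le_trans _ _ (\int[mu]_(t in `]y, z]) (c n)%:E)%E).
    by rewrite integral_cst// muyz// -EFinM lee_fin.
  apply: ge0_le_integral => //.
  - by move=> t _; rewrite lee_fin ltW.
  - exact: measurable_funTS.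
  - move=> t /= tyz.
    apply: le_trans (nneseries_lim_ge n.+1 _) => /=; last by move=> *; exact: g_ge0.
    rewrite big_nat_recr//= indicE mem_set ?mule1; last exact: yzU.
    by rewrite leeDr// sume_ge0.
(* [e1] controls the slopes from [x] by [c n]; [e2] keeps the interval inside [U n], where [g] is at
   least [c n]. *)
exists (Num.min e1 e2); first by rewrite lt_min e10.
split=> [y /andP[xy yx]|z /andP[xz zx]].
- have xyd : x - y < Num.min e1 e2 by rewrite ltrBlDl -ltrBlDr.
  move: xyd; rewrite lt_min => /andP[xy1 xy2].
  apply: key => //.
    move=> t /=; rewrite in_itv/= => /andP[yt tx]; apply: he2; rewrite /ball/=.
    by rewrite ger0_norm ?subr_ge0//; lra.
  have := he1 y; rewrite distrC ger0_norm ?subr_ge0// => /(_ xy1).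
  by rewrite distrC; apply: le_trans; rewrite ler_norm.
- have xzd : z - x < Num.min e1 e2 by rewrite ltrBlDl.
  move: xzd; rewrite lt_min => /andP[xz1 xz2].
  apply: key => //.
    move=> t /=; rewrite in_itv/= => /andP[xt tz]; apply: he2; rewrite /ball/=.
    by rewrite ltr0_norm ?subr_lt0//; lra.
  have := he1 z; rewrite ger0_norm ?subr_ge0// => /(_ xz1).
  by apply: le_trans; rewrite ler_norm.
Qed.

(** * Cheeger's inequality on the line *)

(** The median is the infimum of the points where the cdf reaches 1/2; right-continuity gives the
    value at the infimum itself. The two halves tell which of the cdf and its complement is the
    smaller on each side of [m]. *)
Lemma cdf_median (d : measure_display) (T : measurableType d) (R : realType)
    (P : probability T R) (X : {RV P >-> R}) :
  exists m, (forall t, t < m -> (cdf X t <= (2^-1)%:E)%E) /\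
            (forall t, m <= t -> ((2^-1)%:E <= cdf X t)%E).
Proof.
pose S := [set t | ((2^-1)%:E <= cdf X t)%E].
have half_gt0 : 0 < (2^-1 : R) by rewrite invr_gt0.
have hlt1 : (2^-1 : R) < 1 by rewrite invf_lt1// ltr1n.
have S0 : S !=set0.
  have [M [_ hM]] := cvg_cdfy1 X
    (@nbhs_open_ereal_gt _ 1 (fun=> 2^-1) hlt1).
  by exists (M + 1); apply/ltW/hM; rewrite ltrDl.
have lS : has_lbound S.
  have [M [_ hM]] := cvg_cdfNy0 X
    (@nbhs_open_ereal_lt _ 0 (fun=> 2^-1) half_gt0).
  exists M => t St; rewrite leNgt; apply/negP => /hM.
  by rewrite /= ltNge => /negP; apply.
exists (inf S); split=> [t tS|t St].
  by rewrite leNgt; apply/negP => /ltW /(ge_inf lS); rewrite leNgt tS.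
apply: (@le_trans _ _ (cdf X (inf S))); last exact: cdf_nondecreasing.
rewrite leNgt; apply/negP => hlt.
have cfin : cdf X (inf S) \is a fin_num by exact: fin_num_measure.
have hc : nbhs (cdf X (inf S)) [set y | (y < (2^-1)%:E)%E].
  rewrite -(fineK cfin); apply: (@nbhs_open_ereal_lt _ _ (fun=> 2^-1)).
  by rewrite -lte_fin fineK.
have [e /= e0 he] := @cdf_right_continuous _ _ _ P X (inf S) _ hc.
have [u Su uS] := inf_adherent e0 (conj S0 lS).
have : (cdf X u < (2^-1)%:E)%E.
  have := ge_inf lS Su; rewrite le_eqVlt => /predU1P[<-//|iu].
  by apply: he => //=; rewrite ltr0_norm ?subr_lt0// opprB ltrBlDl.
by rewrite ltNge => /negP; apply.
Qed.

(** * Integration against a measure given by a density *)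

Section density.
Context (R : realType) (nu : probability (measurableTypeR R) R) (rho : R -> R).
Local Notation mu := (@lebesgue_measure R).
Hypotheses (mrho : measurable_fun [set: measurableTypeR R] rho)
  (rho0 : forall x, 0 <= rho x)
  (nu_rho : forall A : set (measurableTypeR R), measurable A ->
    nu A = (\int[mu]_(x in A) (rho x)%:E)%E).

(** [rho] and the Radon-Nikodym derivative have equal integrals over every measurable set, hence
    agree almost everywhere. *)
Lemma ge0_integral_density (g : measurableTypeR R -> \bar R) :
  measurable_fun [set: measurableTypeR R] g -> (forall x, (0 <= g x)%E) ->
  (\int[nu]_x g x = \int[mu]_x (g x * (rho x)%:E))%E.
Proof.
move=> mg g0.
have dom : nu `<< mu.
  apply/null_content_dominatesP => A mA muA0; rewrite nu_rho//.
  apply: null_set_integral => //.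
  by apply/measurable_funTS/measurable_EFinP.
rewrite -(Radon_Nikodym_SigmaFinite.change_of_variables dom)//.
have fi := Radon_Nikodym_SigmaFinite.f_integrable dom.
apply: ae_eq_integral => //.
- by apply: emeasurable_funM => //; exact: (measurable_int mu).
- by apply: emeasurable_funM => //; apply/measurable_EFinP.
apply: ae_eqe_mul2l.
apply: integral_ae_eq => //; first exact/measurable_EFinP.
by move=> E _ mE; rewrite -Radon_Nikodym_SigmaFinite.f_integral//; exact: nu_rho.
Qed.

End density.

Section cheeger_poincare.
Context (d : measure_display) (T : measurableType d) (R : realType)
  (P : probability T R) (X : {RV P >-> R}).
Local Notation mu := (@lebesgue_measure R).
Local Notation nu := (distribution P X).
Let tail t : \bar R := Order.min (cdf X t) (1 - cdf X t)%E.

Let tail_ge0 t : (0 <= tail t)%E.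
Proof. by rewrite le_min cdf_ge0/= -ccdf_1_cdf; exact: measure_ge0. Qed.

Let tail_le1 t : (tail t <= 1)%E.
Proof. by rewrite ge_min cdf_le1. Qed.

Let tail_measurable : measurable_fun [set: measurableTypeR R] tail.
Proof.
have mF : measurable_fun [set: measurableTypeR R] (cdf X) by exact: (cdf_measurable X).
by apply: measurable_mine => //; apply: emeasurable_funB.
Qed.

(* Fubini: u x is at most the integral of |u'| between the median m and x, and
   the set of the x that are separated from m by t has measure at most tail t. *)
Lemma integral_le_tail_derive1 (m : R) (u : R -> R) :
  (forall t, t < m -> (cdf X t <= (2^-1)%:E)%E) ->
  (forall t, m <= t -> ((2^-1)%:E <= cdf X t)%E) ->
  (forall x, derivable u x 1) -> (forall x, 0 <= u x) -> u m = 0 ->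
  (\int[nu]_x (u x)%:E <= \int[mu]_t ((`|u^`()%classic t|)%:E * tail t))%E.
Proof.
move=> mlt mge du u0 um0.
pose G (t : measurableTypeR R) : \bar R := (`|u^`()%classic t|)%:E.
have mG : measurable_fun [set: measurableTypeR R] G.
  by apply/measurable_EFinP; apply: measurableT_comp => //; exact: measurable_derive1.
have G0 t : (0 <= G t)%E by rewrite lee_fin.
(* [t] separates [m] from [x]. The inequality [t < x] is strict so that, for [t >= m], the
   admissible [x] have mass exactly [1 - cdf X t]. *)
pose b (x t : R) := (m <= t) && (t < x) || (x < t) && (t < m).
pose S := [set z : measurableTypeR R * measurableTypeR R | b z.1 z.2].
have mS : measurable S.
  rewrite -[S]setTI; apply: (_ : measurable_fun setT
    (fun z : measurableTypeR R * measurableTypeR R => b z.1 z.2)) => //.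
  apply: measurable_or; apply: measurable_and.
  - exact: measurable_fun_ler.
  - exact: measurable_fun_ltr.
  - exact: measurable_fun_ltr.
  - exact: measurable_fun_ltr.
pose h (z : measurableTypeR R * measurableTypeR R) : \bar R := (G z.2 * (\1_S z)%:E)%E.
have mh : measurable_fun setT h.
  apply: emeasurable_funM; first exact: measurableT_comp.
  by apply/measurable_EFinP; exact: measurable_indic.
have h0 z : (0 <= h z)%E by rewrite mule_ge0// lee_fin.
apply: (@le_trans _ _ (\int[nu]_x \int[mu]_t h (x, t))%E).
  apply: ge0_le_integral => //.
  - by move=> x _; rewrite lee_fin.
  - apply/measurable_EFinP; apply: continuous_measurable_fun => x.
    by apply: differentiable_continuous; exact/derivable1_diffP.
  - exact: (measurable_fun_fubini_tonelli_F (m2 := mu) h mh h0).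
  - move=> x _; have hxA (A : set (measurableTypeR R)) : measurable A ->
        (forall t, A t -> b x t) -> (\int[mu]_(t in A) G t <= \int[mu]_t h (x, t))%E.
      move=> mA Ab; apply: (@le_trans _ _ (\int[mu]_(t in A) h (x, t))%E).
        apply: ge0_le_integral => //.
        + exact: (measurable_funTS mG).
        + by apply: measurable_funTS; exact: (measurableT_comp mh (pair1_measurable x)).
        + by move=> t At; rewrite /h indicE mem_set ?mule1//; exact: Ab.
      apply: ge0_subset_integral => //; exact: (measurableT_comp mh (pair1_measurable x)).
    have [mx|xm] := leP m x.
    + have := derive1_increment_le du mx; rewrite um0 subr0 => /le_trans; apply.
      rewrite -integral_itv_bndo_bndc; last exact: (measurable_funTS mG).
      by apply: hxA => // t /=; rewrite in_itv/= /b => ->.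
    (* To the left of [m] the value [u x] is the increment of [- u] from [x] to [m]. *)
    + have dNu y : derivable (fun y => - u y) y 1 by exact: derivableN.
      have := derive1_increment_le dNu (ltW xm); rewrite um0 oppr0 sub0r opprK.
      move=> /le_trans; apply.
      rewrite (eq_integral G); last first.
        by move=> t _; rewrite /G derive1E deriveN// normrN -derive1E.
      rewrite -integral_itv_bndo_bndc; last exact: (measurable_funTS mG).
      rewrite -integral_itv_obnd_cbnd; last exact: (measurable_funTS mG).
      by apply: hxA => // t /=; rewrite in_itv/= /b => ->; rewrite orbT.
rewrite fubini_tonelli//; apply: ge0_le_integral => //.
- by move=> t _; exact: integral_ge0.
- exact: (measurable_fun_fubini_tonelli_G (m1 := nu) h mh h0).
- by apply: emeasurable_funM.
- move=> t _; rewrite /h/= ge0_integralZl//; last first.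
    have m1S : measurable_fun [set: measurableTypeR R] (fun x => \1_S (x, t) : R).
      by apply: (measurableT_comp (measurable_indic mS)); exact: pair2_measurable.
    exact/measurable_EFinP.
  apply: lee_wpmul2l; first by rewrite lee_fin.
  pose B : set (measurableTypeR R) := [set x | b x t].
  have mB : measurable B.
    have := measurable_ysection t mS; congr measurable.
    by apply/seteqP; split=> x; rewrite /ysection/= inE.
  rewrite (_ : (fun x => _) = (fun x => (\1_B x)%:E)); last first.
    by apply/funext => x; rewrite !indicE; congr (_%:R%:E); apply/idP/idP; rewrite !inE.
  rewrite integral_indic// setIT.
  have Ffin : cdf X t \is a fin_num by exact: fin_num_measure.
  have [mt|tm] := leP m t.
  + have -> : B = `]t, +oo[%classic.
      have bE x : b x t = (t < x) by rewrite /b mt (ltNge t m) mt andbF orbF.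
      by apply/seteqP; split=> x; rewrite /B/= in_itv/= andbT bE.
    apply: (@le_trans _ _ (1 - cdf X t)%E); first by rewrite -ccdf_1_cdf.
    (* Beyond the median the cdf is at least 1/2, so the minimum is [1 - cdf X t]. *)
    rewrite le_min lexx andbT.
    have := mge t mt; rewrite -(fineK Ffin) -EFinB !lee_fin; lra.
  + have Ble : (nu B <= cdf X t)%E.
      have bE x : b x t = (x < t) by rewrite /b (leNgt m t) tm/= andbT.
      apply: le_measure; rewrite ?inE// => x; rewrite /B/= in_itv/= bE.
      exact: ltW.
    apply: (le_trans Ble); rewrite le_min lexx/=.
    have := mlt t tm; rewrite -(fineK Ffin) -EFinB !lee_fin; lra.
Qed.

Lemma cheeger_constant_ge0 (rho : R -> R) : (forall x, 0 < rho x) ->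
  (0 <= cheeger_constant X rho)%E.
Proof.
move=> rho0; apply: le_trans (ereal_sup_ubound _); last by exists 0.
by rewrite mule_ge0 ?tail_ge0// lee_fin invr_ge0 ltW.
Qed.

(** [m] is chosen before [q], so that one base point serves all slices. Finiteness of the left side
    allows it to be absorbed after AM-GM. *)
Lemma cheeger_poincare (rho : R -> R) : boltzmann_density nu rho ->
  exists m, forall q : R -> R, (forall x, derivable q x 1) ->
    (\int[nu]_x ((q x - q m) ^+ 2)%:E < +oo)%E ->
    (\int[nu]_x ((q x - q m) ^+ 2)%:E <=
     (4%:E * cheeger_constant X rho ^+ 2) * \int[nu]_x (q^`()%classic x ^+ 2)%:E)%E.
Proof.
move=> [[v [c [cv c0 rhoE]]] nu_rho].
have rho_gt0 x : 0 < rho x by rewrite rhoE mulr_gt0 ?expR_gt0.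
have mrho : measurable_fun [set: measurableTypeR R] rho.
  rewrite (_ : rho = fun x => c * expR (- v x)); last exact/funext.
  apply: measurable_funM => //; apply: measurableT_comp => //.
  by apply: measurableT_comp => //; exact: continuous_measurable_fun.
have [m [mlt mge]] := cdf_median X.
exists m => q dq Afin.
pose h x := q x - q m.
pose u x := h x ^+ 2.
have dh x : derivable h x 1 by apply: derivableB => //; exact: derivable_cst.
have h'E x : h^`()%classic x = q^`()%classic x.
  by rewrite !derive1E deriveB// derive_cst subr0.
have du x : derivable u x 1 by apply: derivableM.
have u'E x : u^`()%classic x = 2 * (h x * q^`()%classic x).
  rewrite -h'E !derive1E [u](_ : _ = h * h)// deriveM//.
  by rewrite /GRing.scale/=; ring.
have mq' : measurable_fun [set: measurableTypeR R] q^`()%classic by exact: measurable_derive1.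
have mu' : measurable_fun [set: measurableTypeR R] u^`()%classic by exact: measurable_derive1.
have mabsu' : measurable_fun [set: measurableTypeR R] (fun t => (`|u^`()%classic t|)%:E).
  by apply/measurable_EFinP; exact: measurableT_comp.
have mh : measurable_fun [set: measurableTypeR R] h.
  apply: continuous_measurable_fun => x.
  by apply: differentiable_continuous; exact/derivable1_diffP.
set A := integral _ _ _ in Afin *.
set B := integral _ _ _.
have A0 : (0 <= A)%E by apply: integral_ge0 => x _; rewrite lee_fin sqr_ge0.
have B0 : (0 <= B)%E by apply: integral_ge0 => x _; rewrite lee_fin sqr_ge0.
have AL : (A <= \int[mu]_t ((`|u^`()%classic t|)%:E * tail t))%E.
  apply: (integral_le_tail_derive1 mlt mge du) => [x|]; first exact: sqr_ge0.
  by rewrite /u /h subrr expr0n.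
have nuE (g : measurableTypeR R -> \bar R) : measurable_fun setT g ->
    (forall x, 0 <= g x)%E -> (\int[nu]_x g x = \int[mu]_x (g x * (rho x)%:E))%E.
  move=> mg g0.
  (* [X'] is [X] with values in the copy of the line on which the density lemma is stated. *)
  have mX : measurable_fun [set: T] (X : T -> measurableTypeR R).
    exact: (@measurable_funPT _ _ _ _ X).
  pose X' : {mfun T >-> measurableTypeR R} := @mfun_Sub _ _ T (measurableTypeR R) X (mem_set mX).
  rewrite ge0_integral_distribution// -(@ge0_integral_distribution _ _ _ _ _ P X' g)//.
  exact: (@ge0_integral_density R (distribution P X')).
set C := cheeger_constant X rho.
have C0 : (0 <= C)%E by exact: cheeger_constant_ge0.
have Cle t : (tail t * ((rho t)^-1)%:E <= C)%E by apply: ereal_sup_ubound; exists t.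
(* Infinite constant first: the right side is +oo unless [B = 0]. In that case [q'] vanishes
   Lebesgue-almost everywhere since [rho > 0], hence so does [u' = 2 h q']. *)
case: C C0 Cle => [r r0 Cle|_ _|//]; last first.
  have [BE|Bneq0] := eqVneq B 0%E; last first.
    rewrite expe2 mulyy gt0_muley ?lte_fin// gt0_mulye ?leey//.
    by rewrite lt_neqAle eq_sym Bneq0.
  rewrite BE mule0; apply: (le_trans AL); rewrite le_eqVlt; apply/orP; left; apply/eqP.
  have /(ae_eq_integral_abs _ measurableT) :
      (\int[mu]_t `|((q^`()%classic t) ^+ 2 * rho t)%:E| = 0)%E.
    rewrite -BE /B nuE.
    - by apply: eq_integral => t _; rewrite gee0_abs// lee_fin mulr_ge0 ?sqr_ge0 ?ltW.
    - by apply/measurable_EFinP; exact: measurable_funX.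
    - by move=> t; rewrite lee_fin sqr_ge0.
  have mq2r : measurable_fun [set: measurableTypeR R]
      (fun t => ((q^`()%classic t) ^+ 2 * rho t)%:E).
    by apply/measurable_EFinP; apply: measurable_funM => //; exact: measurable_funX.
  move=> /(_ mq2r) q0.
  rewrite -[RHS](integral0 mu setT); apply: ae_eq_integral => //.
    exact: emeasurable_funM.
  apply: filterS q0 => t /= /(_ I) [] /eqP; rewrite mulf_eq0 expf_eq0/= (gt_eqF (rho_gt0 t)) orbF.
  by move=> /eqP q'0 _; rewrite u'E q'0 !mulr0 normr0 mul0e.
have r20 : 0 <= 2 * r ^+ 2 by rewrite mulr_ge0// sqr_ge0.
have rB0 : (0 <= (2 * r ^+ 2)%:E * B)%E by rewrite mule_ge0.
have : (A <= (2^-1)%:E * A + (2 * r ^+ 2)%:E * B)%E.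
  apply: (le_trans AL).
  apply: (@le_trans _ _ (\int[mu]_t (r%:E * ((`|u^`()%classic t|)%:E * (rho t)%:E)))%E).
    apply: ge0_le_integral => //.
    - by move=> t _; rewrite mule_ge0 ?lee_fin.
    - exact: emeasurable_funM.
    - by apply: emeasurable_funM => //; apply: emeasurable_funM => //; exact/measurable_EFinP.
    - move=> t _; rewrite muleCA lee_wpmul2l ?lee_fin//.
      (* The supremum is used in the form [tail t <= r * rho t], which trades Lebesgue measure for
         [nu]. *)
      have Ffin : tail t \is a fin_num.
        by rewrite ge0_fin_numE// (le_lt_trans (tail_le1 t))// ltry.
      have := Cle t; rewrite -(fineK Ffin) -!EFinM !lee_fin.
      by rewrite ler_pdivrMr.
  rewrite ge0_integralZl//; last 2 first.
  - by apply: emeasurable_funM => //; exact/measurable_EFinP.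
  - by move=> t _; rewrite -EFinM lee_fin mulr_ge0// ltW.
  rewrite -(nuE (fun t => (`|u^`()%classic t|)%:E))//.
  have mu2 : measurable_fun [set: measurableTypeR R] (fun t => (2^-1)%:E * (u t)%:E)%E.
    by apply: emeasurable_funM => //; apply/measurable_EFinP; exact: measurable_funX.
  have mq2 : measurable_fun [set: measurableTypeR R] (fun t => (q^`()%classic t ^+ 2)%:E).
    by apply/measurable_EFinP; exact: measurable_funX.
  have mq2' : measurable_fun [set: measurableTypeR R]
      (fun t => (2 * r ^+ 2)%:E * (q^`()%classic t ^+ 2)%:E)%E.
    exact: emeasurable_funM.
  apply: (@le_trans _ _ (\int[nu]_x ((2^-1)%:E * (u x)%:E +
      (2 * r ^+ 2)%:E * (q^`()%classic x ^+ 2)%:E))%E).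
    rewrite -ge0_integralZl//; apply: ge0_le_integral => //.
    - by move=> t _; rewrite mule_ge0 ?lee_fin.
    - exact: emeasurable_funM.
    - exact: emeasurable_funD.
    - (* AM-GM: 2 r |h q'| <= h^2 / 2 + 2 r^2 q'^2 *)
      move=> t _; rewrite -!EFinM -EFinD lee_fin u'E /u.
      rewrite -(real_normK (num_real (h t))) -(real_normK (num_real (q^`()%classic t))).
      rewrite !normrM (ger0_norm (ler0n _ 2)).
      have := sqr_ge0 (`|h t| - 2 * r * `|q^`()%classic t|); nra.
  rewrite ge0_integralD//; last 2 first.
  - by move=> t _; rewrite mule_ge0 ?lee_fin ?sqr_ge0.
  - by move=> t _; rewrite mule_ge0 ?lee_fin ?sqr_ge0.
  rewrite !ge0_integralZl// ?lee_fin//.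
  - by move=> t _; rewrite lee_fin sqr_ge0.
  - by apply/measurable_EFinP; exact: measurable_funX.
  - by move=> t _; rewrite lee_fin sqr_ge0.
(* With [w = 2 r^2 B], the bound [A <= A / 2 + w] gives [A <= w + w] as [A] is finite. *)
have -> : ((4%:E * r%:E ^+ 2) * B = (2 * r ^+ 2)%:E * B + (2 * r ^+ 2)%:E * B)%E.
  by rewrite -ge0_muleDl// -EFinD -EFin_expe -EFinM; congr (_%:E * _)%E; ring.
have Af : A \is a fin_num by rewrite ge0_fin_numE.
rewrite -(fineK Af).
move: ((2 * r ^+ 2)%:E * B)%E rB0 => [w _| |//]; last by rewrite leey.
by rewrite -EFinM -!EFinD !lee_fin => ?; lra.
Qed.

End cheeger_poincare.

(** * Square integrable functions *)

Section square_integrable.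
Context d (T : measurableType d) (R : realType) (mu : {measure set T -> \bar R}).
Implicit Types f g : T -> R.

Definition square_integrable f :=
  measurable_fun [set: T] f /\ (\int[mu]_x (f x ^+ 2)%:E < +oo)%E.

Lemma square_integrableM f g : square_integrable f -> square_integrable g ->
  mu.-integrable [set: T] (EFin \o (fun x => f x * g x)).
Proof.
move=> [mf f2] [mg g2]; apply/integrableP; split.
  by apply/measurable_EFinP; exact: measurable_funM.
have mf2 : measurable_fun [set: T] (fun x => (f x ^+ 2)%:E).
  by apply/measurable_EFinP; exact: measurable_funX.
have mg2 : measurable_fun [set: T] (fun x => (g x ^+ 2)%:E).
  by apply/measurable_EFinP; exact: measurable_funX.
apply: (@le_lt_trans _ _ (\int[mu]_x ((f x ^+ 2)%:E + (g x ^+ 2)%:E))%E).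
  apply: ge0_le_integral => //.
  - apply: measurableT_comp => //; apply/measurable_EFinP; exact: measurable_funM.
  - exact: emeasurable_funD.
  - move=> x _; rewrite /= lee_fin normrM.
    rewrite -(real_normK (num_real (f x))) -(real_normK (num_real (g x))).
    have := sqr_ge0 (`|f x| - `|g x|); have := sqr_ge0 (`|f x| + `|g x|); nra.
rewrite ge0_integralD//; first by rewrite lte_add_pinfty.
- by move=> x _; rewrite lee_fin sqr_ge0.
- by move=> x _; rewrite lee_fin sqr_ge0.
Qed.

Lemma square_integrableD f g : square_integrable f -> square_integrable g ->
  square_integrable (fun x => f x + g x).
Proof.
move=> [mf f2] [mg g2]; split; first exact: measurable_funD.
have mf2 : measurable_fun [set: T] (fun x => (2 * f x ^+ 2)%:E).
  by apply/measurable_EFinP; apply: measurable_funM => //; exact: measurable_funX.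
have mg2 : measurable_fun [set: T] (fun x => (2 * g x ^+ 2)%:E).
  by apply/measurable_EFinP; apply: measurable_funM => //; exact: measurable_funX.
apply: (@le_lt_trans _ _ (\int[mu]_x ((2 * f x ^+ 2)%:E + (2 * g x ^+ 2)%:E))%E).
  apply: ge0_le_integral => //.
  - by move=> x _; rewrite lee_fin sqr_ge0.
  - by apply/measurable_EFinP; apply: measurable_funX; exact: measurable_funD.
  - exact: emeasurable_funD.
  - move=> x _; rewrite /= lee_fin; have := sqr_ge0 (f x - g x); nra.
rewrite ge0_integralD//; last 2 first.
- by move=> x _; rewrite lee_fin mulr_ge0// sqr_ge0.
- by move=> x _; rewrite lee_fin mulr_ge0// sqr_ge0.
have dbl (h : T -> R) : measurable_fun setT h -> (\int[mu]_x (h x ^+ 2)%:E < +oo)%E ->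
    (\int[mu]_x (2 * h x ^+ 2)%:E < +oo)%E.
  move=> mh h2; under eq_integral do rewrite EFinM.
  rewrite ge0_integralZl//.
  - by rewrite lte_mul_pinfty.
  - by apply/measurable_EFinP; exact: measurable_funX.
  - by move=> x _; rewrite lee_fin sqr_ge0.
by rewrite lte_add_pinfty// dbl.
Qed.

Lemma square_integrableN f : square_integrable f -> square_integrable (fun x => - f x).
Proof.
move=> [mf f2]; split; first exact: measurableT_comp.
by under eq_integral do rewrite sqrrN.
Qed.

Lemma square_integrable_sum (I : Type) (s : seq I) (Q : pred I) (F : I -> T -> R) :
  (forall i, Q i -> square_integrable (F i)) ->
  square_integrable (fun x => \sum_(i <- s | Q i) F i x).
Proof.
move=> F2; elim: s => [|i s IH].
  rewrite (_ : (fun x => _) = cst 0); last by apply/funext => x; rewrite big_nil.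
  by split => //; rewrite integral0_eq ?ltry// => x _; rewrite expr0n.
have [Qi|nQi] := boolP (Q i).
  rewrite (_ : (fun x => _) = (fun x => F i x + \sum_(j <- s | Q j) F j x)).
    exact: square_integrableD (F2 i Qi) IH.
  by apply/funext => x; rewrite big_cons Qi.
rewrite (_ : (fun x => _) = (fun x => \sum_(j <- s | Q j) F j x))//.
by apply/funext => x; rewrite big_cons (negbTE nQi).
Qed.

(** Real-valued, so that Gram sums can be subtracted; for square integrable arguments the integral
    is finite and [fine] loses nothing. *)
Definition inner_product f g : R := fine (\int[mu]_x (f x * g x)%:E)%E.

Lemma inner_productC f g : inner_product f g = inner_product g f.
Proof. by congr fine; apply: eq_integral => x _; rewrite mulrC. Qed.

Lemma inner_productDl f g h : square_integrable f -> square_integrable g ->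
  square_integrable h ->
  inner_product (fun x => f x + g x) h = inner_product f h + inner_product g h.
Proof.
move=> f2 g2 h2; have fh := square_integrableM f2 h2; have gh := square_integrableM g2 h2.
rewrite /inner_product -fineD; [|exact: integrable_fin_num fh|exact: integrable_fin_num gh].
congr fine; rewrite -(integralD measurableT fh gh).
by apply: eq_integral => x _; rewrite mulrDl EFinD.
Qed.

Lemma inner_product_suml (I : Type) (s : seq I) (Q : pred I) (F : I -> T -> R) h :
  (forall i, Q i -> square_integrable (F i)) -> square_integrable h ->
  inner_product (fun x => \sum_(i <- s | Q i) F i x) h =
  \sum_(i <- s | Q i) inner_product (F i) h.
Proof.
move=> F2 h2; elim: s => [|i s IH].
  rewrite big_nil /inner_product (eq_integral (cst 0%E)) ?integral0// => x _.
  by rewrite big_nil mul0r.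
rewrite big_cons -IH; case: ifPn => Qi; last first.
  by congr fine; apply: eq_integral => x _; rewrite big_cons (negbTE Qi).
rewrite -inner_productDl//; [|exact: F2|exact: square_integrable_sum].
by congr fine; apply: eq_integral => x _; rewrite big_cons Qi.
Qed.

End square_integrable.

Section square_integrable_probability.
Context d (T : measurableType d) (R : realType) (mu : probability T R).
Implicit Types f g : T -> R.
Local Notation square_integrable := (square_integrable mu).

Lemma square_integrable_cst (c : R) : square_integrable (cst c).
Proof.
split => //; rewrite (eq_integral (cst (c ^+ 2)%:E))//.
by rewrite integral_cst//= probability_setT mule1 ltry.
Qed.

Lemma square_integrable_integrable f : square_integrable f ->
  mu.-integrable [set: T] (EFin \o f).
Proof.
move=> f2; have := square_integrableM f2 (square_integrable_cst 1).
by rewrite (_ : EFin \o (fun x => f x * cst 1 x) = EFin \o f)//; apply/funext => x/=; rewrite mulr1.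
Qed.

Lemma integral_sqr_sub f (c : R) : square_integrable f ->
  (\int[mu]_x ((f x - c) ^+ 2)%:E = \int[mu]_x (f x ^+ 2)%:E
    - (2 * c * fine (\int[mu]_x (f x)%:E))%:E + (c ^+ 2)%:E)%E.
Proof.
move=> f2; have f1 := square_integrable_integrable f2.
have fin1 : (\int[mu]_x (f x)%:E)%E \is a fin_num by exact: integrable_fin_num.
have ff : mu.-integrable [set: T] (EFin \o (fun x => f x ^+ 2)) := square_integrableM f2 f2.
have fc : mu.-integrable [set: T] (fun x => (- (2 * c))%:E * (f x)%:E)%E.
  exact: integrableZl.
transitivity (\int[mu]_x ((f x ^+ 2)%:E + ((- (2 * c))%:E * (f x)%:E) + (c ^+ 2)%:E))%E.
  by apply: eq_integral => x _; rewrite -EFinM -!EFinD; congr EFin; ring.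
rewrite integralD//=; last 2 first.
- exact: (integrableD measurableT ff fc).
- exact: finite_measure_integrable_cst.
rewrite integralD//= integralZl// integral_cst//= probability_setT mule1.
by rewrite -(fineK fin1)/= -EFinM mulNr EFinN.
Qed.

(** Expand the nonnegative integral of [(f - c) ^ 2] with [c] the mean. *)
Lemma jensen_sqr f : square_integrable f ->
  ((fine (\int[mu]_x (f x)%:E) ^+ 2)%:E <= \int[mu]_x (f x ^+ 2)%:E)%E.
Proof.
move=> f2; set c := fine _.
have : (0 <= \int[mu]_x ((f x - c) ^+ 2)%:E)%E.
  by apply: integral_ge0 => x _; rewrite lee_fin sqr_ge0.
rewrite integral_sqr_sub// -/c.
have f2fin : (\int[mu]_x (f x ^+ 2)%:E)%E \is a fin_num.
  by rewrite ge0_fin_numE ?f2.2//; apply: integral_ge0 => x _; rewrite lee_fin sqr_ge0.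
by rewrite -(fineK f2fin) -EFinB -EFinD !lee_fin; nra.
Qed.

Lemma integral_sqr_le_sub f (c : R) : square_integrable f ->
  (\int[mu]_x (f x ^+ 2)%:E <=
   (fine (\int[mu]_x (f x)%:E) ^+ 2)%:E + \int[mu]_x ((f x - c) ^+ 2)%:E)%E.
Proof.
move=> f2; rewrite integral_sqr_sub//.
have f2fin : (\int[mu]_x (f x ^+ 2)%:E)%E \is a fin_num.
  by rewrite ge0_fin_numE ?f2.2//; apply: integral_ge0 => x _; rewrite lee_fin sqr_ge0.
rewrite -(fineK f2fin) -EFinB -!EFinD !lee_fin.
set a := fine (\int[mu]_x (f x)%:E); have := sqr_ge0 (a - c); nra.
Qed.

End square_integrable_probability.

(* K u v stands for the inner product of the Hoeffding components of u and v;
   its sums over subsets are the inner products of conditional expectations. *)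
Section subset_sums.
Context (I : finType) (R : realType) (K : {set I} -> {set I} -> R).
Hypothesis K_sym : forall u v, K u v = K v u.
Let S (u w : {set I}) := \sum_(v : {set I} | v \subset u) \sum_(z : {set I} | z \subset w) K v z.
Hypothesis S_cap : forall u w, S u w = S (u :&: w) w.

(** By [S_cap] the rows [v] inside [u] but not inside [w] have total sum 0; all of them except [u]
    itself vanish by induction on the size of [u]. *)
Let row_eq0 n (u w : {set I}) : (#|u| < n)%N -> ~~ (u \subset w) ->
  \sum_(z : {set I} | z \subset w) K u z = 0.
Proof.
elim: n u => // n IH u un uw.
pose row v := \sum_(z : {set I} | z \subset w) K v z.
have Scap : \sum_(v : {set I} | v \subset u) row v
  = \sum_(v : {set I} | v \subset u :&: w) row v by exact: S_cap.
have out : \sum_(v : {set I} | (v \subset u) && ~~ (v \subset w)) row v = row u.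
  rewrite (bigD1 u)/= ?subxx// big1 ?addr0// => v /andP[/andP[vu vw] vneu].
  apply: IH => //; apply: (@leq_trans #|u|) => //.
  by rewrite proper_card// finset.properEneq vneu.
have := Scap; rewrite (bigID (fun v : {set I} => v \subset w))/= out.
rewrite (eq_bigl (fun v : {set I} => v \subset u :&: w)); last first.
  by move=> v; rewrite finset.subsetI.
by move/(canRL (addKr _)); rewrite addrC subrr.
Qed.

(** A proper subset of [w] does not contain [u] either, so by induction the vanishing row sum
    reduces to its last entry [K u w]. *)
Lemma kernel_eq0 n (u w : {set I}) : (#|w| < n)%N -> ~~ (u \subset w) -> K u w = 0.
Proof.
elim: n w => // n IH w wn uw.
have := @row_eq0 #|u|.+1 u w (ltnSn _) uw.
rewrite (bigD1 w)//= big1 ?addr0// => z /andP[zw znew]; apply: IH.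
  apply: (@leq_trans #|w|) => //.
  by rewrite proper_card// finset.properEneq znew.
by apply: contra uw => uz; exact: fintype.subset_trans uz zw.
Qed.

(** Of two distinct sets one is not contained in the other, so [kernel_eq0] and symmetry kill every
    off-diagonal term. *)
Let diag_sum (u : {set I}) : S u u = \sum_(v : {set I} | v \subset u) K v v.
Proof.
apply: eq_bigr => v vu; rewrite (bigD1 v)//= big1 ?addr0// => z /andP[zu zv].
have [vz|vz] := boolP (v \subset z); last exact: (@kernel_eq0 #|z|.+1).
rewrite K_sym (@kernel_eq0 #|v|.+1)//.
by apply: contra zv => zv; rewrite finset.eqEsubset zv.
Qed.

Lemma sum_diag_containing (j : I) :
  \sum_(v : {set I} | j \in v) K v v = S [set: I] [set: I] - S (~: [set j]) (~: [set j]).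
Proof.
rewrite !diag_sum; apply/(canRL (addrK _)).
rewrite [RHS](bigID (fun v : {set I} => j \in v))/=; congr (_ + _).
  by apply: eq_bigl => v; rewrite finset.subsetT.
by apply: eq_bigl => v; rewrite finset.subsetT/= finset.subsetC finset.sub1set inE.
Qed.

End subset_sums.

(** * The Borel sigma-algebra of row vectors *)

Section row_space.
Context (R : realType) (d : nat).

Definition box (A : 'I_d -> set R) : set 'rV[R]_d := [set x | forall i, A i (x 0 i)].

Definition boxes : set (set 'rV[R]_d) :=
  [set B | exists2 A : 'I_d -> set R, (forall i, measurable (A i)) & B = box A].

(** The row vectors with the product sigma-algebra. Boxes are stable under intersection, as
    uniqueness of measures requires, and [open_measurable_row] recovers the open sets. *)
Definition row_space := g_sigma_algebraType boxes.

Lemma boxesT : [set [set: 'rV[R]_d]] `<=` boxes.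
Proof.
by move=> _ ->; exists (fun=> setT) => //; apply/seteqP; split.
Qed.

Lemma boxesI : setI_closed boxes.
Proof.
move=> _ _ [A mA ->] [B mB ->]; exists (fun i => A i `&` B i).
  by move=> i; exact: measurableI.
apply/seteqP; split=> [x [Ax Bx] i|x AB]; first by split; [exact: Ax|exact: Bx].
by split=> i; have [] := AB i.
Qed.

Lemma measurable_box (A : 'I_d -> set R) : (forall i, measurable (A i)) ->
  measurable (box A : set row_space).
Proof. by move=> mA; apply: sub_sigma_algebra; exists A. Qed.

Lemma measurable_coord (i : 'I_d) :
  measurable_fun [set: row_space] (fun x : row_space => (x : 'rV[R]_d) 0 i).
Proof.
move=> _ A mA; rewrite setTI.
have := @measurable_box (fun k => if k == i then A else setT).
rewrite (_ : box _ = (fun x : 'rV[R]_d => x 0 i) @^-1` A); first by apply=> k; case: ifP.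
apply/seteqP; split=> [x /(_ i)|x Ax k]; first by rewrite eqxx.
by case: eqP => // ->.
Qed.

Lemma measurable_row d' (T : measurableType d') (Z : T -> 'rV[R]_d) :
  (forall i, measurable_fun [set: T] (fun w => Z w 0 i)) ->
  measurable_fun [set: T] (Z : T -> row_space).
Proof.
move=> mZ; apply: (@measurability _ _ T row_space setT Z boxes) => //.
move=> _ [_ [A mA ->] <-]; rewrite setTI.
rewrite (_ : _ @^-1` _ = \bigcap_(i in [set: 'I_d]) ((fun w => Z w 0 i) @^-1` A i)).
  apply: fin_bigcap_measurable => // i _.
  by rewrite -[X in measurable X]setTI; exact: mZ.
by apply/seteqP; split=> [w h i _|w h i]; [exact: h|exact: (h i I)].
Qed.

(* An open set is the union of the rational boxes that it contains. *)
Lemma open_measurable_row (O : set 'rV[R]_d) : open O -> measurable (O : set row_space).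
Proof.
move=> oO.
pose cube (c : 'rV[rat]_d) n : set 'rV[R]_d :=
  box (fun i => ball (ratr (c 0 i) : R) n.+1%:R^-1).
have mcube c n : measurable (cube c n : set row_space).
  by apply: measurable_box => i; exact: measurable_ball.
pose W (p : 'rV[rat]_d * nat) : set row_space :=
  if `[< cube p.1 p.2 `<=` O >] then cube p.1 p.2 else set0.
rewrite (_ : O = \bigcup_p W p).
  apply: countable_bigcupT_measurable => [|p]; first exact: countableP.
  by rewrite /W; case: ifP.
apply/seteqP; split=> [x Ox|x [p _]]; last first.
  by rewrite /W; case: ifPn => // /asboolP; apply.
have /nbhs_ballP[e /= e0 xO] : nbhs x O by exact: open_nbhs_nbhs.
(* Two points of a cube of this radius are within [e] of each other, by the triangle inequality
   through its centre. *)
have [n ne] : exists n, n.+1%:R^-1 < e / 2.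
  have e20 : 0 < e / 2 by rewrite divr_gt0.
  have [N _ hN] := near_infty_natSinv_lt (PosNum e20).
  by exists N; apply: hN => /=.
have n0 : 0 < n.+1%:R^-1 :> R by rewrite invr_gt0.
have /choice[q hq] : forall i, exists q : rat, `|ratr q - x 0 i| < n.+1%:R^-1.
  move=> i; have [q hq] := @rat_in_itvoo R (x 0 i - n.+1%:R^-1) (x 0 i + n.+1%:R^-1)
    ltac:(by rewrite ltrBlDr -addrA ltrDl addr_gt0).
  exists q; move: hq; rewrite in_itv/= => /andP[h1 h2].
  by rewrite ltr_norml ltrBrDl h1/= ltrBlDl h2.
have cx : cube (\row_i q i) n x.
  by move=> i; rewrite /ball/= mxE; exact: hq.
exists (\row_i q i, n) => //; rewrite /W; case: ifPn => // /asboolP; case=> y cy.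
apply: xO; rewrite /ball/=; split=> // i j; rewrite ord1 /ball/=.
have := cx j; have := cy j; rewrite /ball/= => h1 h2.
have -> : x 0 j - y 0 j = (ratr ((\row_i q i) 0 j) - y 0 j)
  - (ratr ((\row_i q i) 0 j) - x 0 j) by ring.
by rewrite (le_lt_trans (ler_normB _ _))// (splitr e) ltrD// (lt_trans _ ne).
Qed.

Lemma continuous_measurable_row (f : 'rV[R]_d -> R) : continuous f ->
  measurable_fun [set: row_space] (f : row_space -> R).
Proof.
move=> /continuousP cf; apply: (measurability _ (RGenOpens.measurableE R)).
move=> _ [_ [a [b ->]] <-]; rewrite setTI; apply: open_measurable_row; apply: cf.
exact: interval_open.
Qed.

Lemma measurable_partial (f : 'rV[R]_d -> R) (j : 'I_d) :
  (forall x, differentiable f x) ->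
  measurable_fun [set: row_space] (partial f j : row_space -> R).
Proof.
move=> df.
pose v : 'rV[R]_d := delta_mx 0 j.
pose h n : R := n.+1%:R^-1.
apply: (@measurable_fun_cvg _ _ _ _
    (fun n (x : row_space) => (h n)^-1 * (f (h n *: v + x) - f x))) => [n|x _].
  apply: measurable_funM => //; apply: measurable_funB; apply: continuous_measurable_row.
    move=> x; apply: continuous_comp.
      by apply: (@continuousD _ _ _ (cst (h n *: v)) id x); [exact: cst_continuous|].
    exact: differentiable_continuous.
  by move=> x; exact: differentiable_continuous.
have cv : t^-1 *: (f (t *: v + x) - f x) @[t --> 0^'] --> partial f j x.
  exact: (@diff_derivable _ _ _ f x v (df x)).
apply: (cvg_comp _ _ _ cv).
move=> A; rewrite /dnbhs/within/= => /nbhs_ballP[e /= e0 he].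
near=> n.
apply: he => /=; last by rewrite invr_neq0.
rewrite /ball/= sub0r normrN ger0_norm ?invr_ge0//.
near: n; exact: near_infty_natSinv_lt (PosNum e0).
Unshelve. all: by end_near. Qed.

End row_space.

(** * Exchanging coordinates of two independent copies *)

(** The image measure is kept abstract behind its values and its change of variables. It serves for
    the image under [swap] and, along the identity, for restricting [P] to a sub-sigma-algebra. *)
Lemma pushforward_measure_integral d1 d2 (T1 : measurableType d1) (T2 : measurableType d2)
    (R : realType) (m : {measure set T1 -> \bar R}) (phi : T1 -> T2) :
  measurable_fun [set: T1] phi ->
  exists m' : {measure set T2 -> \bar R},
    (forall A, m' A = m (phi @^-1` A)) /\
    (forall D F, measurable D -> measurable_fun [set: T2] F ->
      m.-integrable (phi @^-1` D) (F \o phi) ->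
      m'.-integrable D F /\
      (\int[m']_(y in D) F y = \int[m]_(x in phi @^-1` D) F (phi x))%E).
Proof.
move=> mphi; unshelve eexists (pushforward m phi) => //; split => // D F mD mF iF; split.
  exact: integrable_pushforward.
exact: integral_pushforward.
Qed.

Section measure_preserving.
Context d (T : measurableType d) (R : realType) (m : {measure set T -> \bar R}).
Context (phi : T -> T) (mphi : measurable_fun [set: T] phi).
Hypothesis phi_inv : forall A, measurable A -> m (phi @^-1` A) = m A.

Lemma ge0_integral_measure_preserving (F : T -> \bar R) :
  measurable_fun setT F -> (forall z, (0 <= F z)%E) ->
  (\int[m]_z F (phi z) = \int[m]_z F z)%E.
Proof.
move=> mF F0.
have := ge0_integral_pushforward mphi m measurableT mF (fun y _ => F0 y).
rewrite preimage_setT => <-.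
by apply: eq_measure_integral => A mA _; exact: phi_inv.
Qed.

Lemma integral_measure_preserving (F : T -> \bar R) :
  measurable_fun setT F -> m.-integrable setT (F \o phi) ->
  (\int[m]_z F (phi z) = \int[m]_z F z)%E.
Proof.
move=> mF iF.
have := integral_pushforward mphi mF (D := setT) iF measurableT.
rewrite preimage_setT => <-.
by apply: eq_measure_integral => A mA _; exact: phi_inv.
Qed.

End measure_preserving.

(** The factors [p i] stand for the laws of the coordinates; the product form lets factors be traded
    between two copies. *)
Definition independent_coordinates (R : realType) (d : nat)
    (mu : set (row_space R d) -> \bar R) : Prop :=
  exists p : 'I_d -> set R -> \bar R,
    forall A : 'I_d -> set R, (forall i, measurable (A i)) ->
      mu (box A) = (\prod_(i < d) p i (A i))%E.

Section resampling.
Context (R : realType) (d : nat).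
Local Notation V := (row_space R d).
Context (mu : probability V R) (indep : independent_coordinates mu).
Implicit Types u w : {set 'I_d}.

Definition mix u (x y : 'rV[R]_d) : 'rV[R]_d := \row_i (if i \in u then x 0 i else y 0 i).

(** The coordinates outside [u] trade places and those in [u] stay. *)
Definition swap u (z : V * V) : V * V := (mix u z.1 z.2, mix u z.2 z.1).

Lemma measurable_mix u : measurable_fun [set: V * V] (fun z => mix u z.1 z.2 : V).
Proof.
apply: measurable_row => i.
rewrite (_ : (fun z => _) = if i \in u then (fun z : V * V => z.1 0 i)
  else (fun z => z.2 0 i)); last by apply/funext => z; rewrite mxE; case: ifP.
case: ifP => _; first exact: (measurableT_comp (measurable_coord i) measurable_fst).
exact: (measurableT_comp (measurable_coord i) measurable_snd).
Qed.

Lemma measurable_swap u : measurable_fun [set: V * V] (swap u).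
Proof.
apply: measurable_fun_pair; first exact: measurable_mix.
have mflip : measurable_fun [set: V * V] (fun z : V * V => (z.2, z.1) : V * V).
  exact: (measurable_fun_pair measurable_snd measurable_fst).
exact: (measurableT_comp (measurable_mix u) mflip).
Qed.

Let rectangles : set (set (V * V)) :=
  [set A `*` B | A in @boxes R d & B in @boxes R d].

Let boxT : @boxes R d setT.
Proof. exact: boxesT. Qed.

(* measurable_prod_g_measurableType requires every set to be a generator. *)
Let rectangles_generate (W : set (V * V)) : measurable W -> <<s rectangles >> W.
Proof.
have m1 : measurable_fun [set: g_sigma_algebraType rectangles] (fst : _ -> V).
  apply: (@measurability _ _ (g_sigma_algebraType rectangles) V setT fst
    (@boxes R d)) => // _ [B bB <-].
  rewrite setTI; apply: sub_sigma_algebra; exists B => //; exists setT => //.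
  by apply/seteqP; split=> [z []|z].
have m2 : measurable_fun [set: g_sigma_algebraType rectangles] (snd : _ -> V).
  apply: (@measurability _ _ (g_sigma_algebraType rectangles) V setT snd
    (@boxes R d)) => // _ [B bB <-].
  rewrite setTI; apply: sub_sigma_algebra; exists setT => //; exists B => //.
  by apply/seteqP; split=> [z []|z].
have := measurable_fun_pair m1 m2 => mid mW.
have := mid measurableT W mW; rewrite setTI.
by congr (<<s rectangles >> _); apply/seteqP; split=> -[].
Qed.

(** Products of two boxes form a generating pi-system. The preimage of one is again such a product,
    with some factors exchanged, and the two measures differ by a commutation. *)
Lemma swap_measure u (W : set (V * V)) : measurable W ->
  (mu \x mu)%E (swap u @^-1` W) = (mu \x mu)%E W.
Proof.
move=> mW; have [p mu_box] := indep; have [m1 [m1E _]] :=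
  pushforward_measure_integral (mu \x mu)%E (measurable_swap u).
rewrite -m1E.
have bm (B : set V) : @boxes R d B -> measurable B by exact: sub_sigma_algebra.
have Gm : rectangles `<=` measurable.
  by move=> _ [A bA [B bB <-]]; apply: measurableX; exact: bm.
have prodE (A B : set V) : measurable A -> measurable B ->
    (mu \x mu)%E (A `*` B) = (mu A * mu B)%E.
  by move=> mA mB; exact: product_measure1E.
have GT : rectangles setT by exists setT => //; exists setT => //; rewrite setXTT.
apply: (@g_sigma_algebra_measure_unique _ R (V * V)%type rectangles Gm (fun=> setT) _ _
   m1 (mu \x mu)%E _ _ _ W (rectangles_generate mW)) => //.
- by rewrite bigcup_const.
- move=> _ _ [A bA [B bB <-]] [C bC [D bD <-]]; rewrite -setXI.
  by exists (A `&` C); [exact: boxesI|exists (B `&` D) => //; exact: boxesI].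
- move=> _ [_ [A mA ->] [_ [B mB ->] <-]]; rewrite m1E.
  pose A' i := if i \in u then A i else B i.
  pose B' i := if i \in u then B i else A i.
  have mA' i : measurable (A' i) by rewrite /A'; case: ifP.
  have mB' i : measurable (B' i) by rewrite /B'; case: ifP.
  rewrite (_ : swap u @^-1` _ = box A' `*` box B'); last first.
    apply/seteqP; split=> -[x y] /= [h1 h2].
      split=> i; rewrite /A' /B'; have := h1 i; have := h2 i; rewrite !mxE;
        by case: ifP.
    split=> i; have := h1 i; have := h2 i; rewrite /A' /B' !mxE; by case: ifP.
  rewrite [LHS]prodE ?[RHS]prodE; [|exact: measurable_box..].
  rewrite !mu_box// -!big_split/=; apply: eq_bigr => i _.
  by rewrite /A' /B'; case: ifP => // _; rewrite muleC.
- move=> _; rewrite m1E preimage_setT -setXTT.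
  rewrite (_ : (_ < _)%E = (mu setT * mu setT < +oo)%E); last by congr (_ < _)%E; exact: prodE.
  by rewrite probability_setT mul1e ltry.
Qed.

Lemma ge0_integral_swap u (F : V * V -> \bar R) : measurable_fun setT F ->
  (forall z, (0 <= F z)%E) ->
  (\int[mu \x mu]_z F (swap u z) = \int[mu \x mu]_z F z)%E.
Proof.
exact: (ge0_integral_measure_preserving (measurable_swap u) (@swap_measure u)).
Qed.

Lemma integral_swap u (F : V * V -> \bar R) : measurable_fun setT F ->
  (mu \x mu)%E.-integrable setT (F \o swap u) ->
  (\int[mu \x mu]_z F (swap u z) = \int[mu \x mu]_z F z)%E.
Proof.
exact: (integral_measure_preserving (measurable_swap u) (@swap_measure u)).
Qed.

End resampling.

(** * Conditional expectations as integrals over the other coordinates *)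

Section marginal.
Context (R : realType) (d : nat).
Local Notation V := (row_space R d).
Context (mu : probability V R) (indep : independent_coordinates mu).
Context (f : V -> R) (f2 : square_integrable mu f).
Implicit Types u w : {set 'I_d}.

(* A version of the conditional expectation of f given the coordinates in u
   (with junk value 0 where f is not integrable in the other coordinates). *)
Definition marginal u (x : V) : R := fine (\int[mu]_y (f (mix u x y))%:E)%E.

Lemma marginal_local u x x' : (forall i, i \in u -> (x : 'rV[R]_d) 0 i = (x' : 'rV[R]_d) 0 i) ->
  marginal u x = marginal u x'.
Proof.
move=> xx'; congr fine; apply: eq_integral => y _; congr (f _)%:E.
by apply/rowP => i; rewrite !mxE; case: ifP => // /xx'.
Qed.

Lemma marginalT x : marginal [set: 'I_d]%SET x = f x.
Proof.
rewrite /marginal (eq_integral (cst (f x)%:E)); last first.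
  move=> y _; congr (f _)%:E; apply/rowP => i; by rewrite mxE finset.in_setT.
by rewrite integral_cst//= probability_setT mule1.
Qed.

Lemma measurable_fun_mix u (g : V -> R) : measurable_fun [set: V] g ->
  measurable_fun [set: V * V] (fun z => g (mix u z.1 z.2)).
Proof. by move=> mg; exact: (measurableT_comp mg (measurable_mix u)). Qed.

(** [mix u x y] is the first component of [swap u (x, y)], hence has law [mu] under the product
    measure. *)
Lemma ge0_integral_mix u (g : V -> R) : measurable_fun [set: V] g ->
  (forall x, 0 <= g x) ->
  (\int[mu]_x (g x)%:E = \int[mu]_x \int[mu]_y (g (mix u x y))%:E)%E.
Proof.
move=> mg g0.
have mg1 : measurable_fun [set: V * V] (fun z => (g z.1)%:E).
  by apply/measurable_EFinP; exact: (measurableT_comp mg measurable_fst).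
have g10 (z : V * V) : (0 <= (g z.1)%:E)%E by rewrite lee_fin.
have mgm : measurable_fun [set: V * V] (fun z => (g (mix u z.1 z.2))%:E).
  by apply/measurable_EFinP; exact: measurable_fun_mix.
have gm0 (z : V * V) : (0 <= (g (mix u z.1 z.2))%:E)%E by rewrite lee_fin.
have e1 := fubini_tonelli1 (m1 := mu) (m2 := mu) _ mg1 g10.
have e2 := fubini_tonelli1 (m1 := mu) (m2 := mu) _ mgm gm0.
have e3 := ge0_integral_swap indep u mg1 g10.
transitivity (\int[mu \x mu]_z (g z.1)%:E)%E; last by rewrite -e3.
rewrite e1; apply: eq_integral => x _; rewrite /fubini_F/=.
by rewrite integral_cst//= probability_setT mule1.
Qed.

Let f2_ge0 x : 0 <= f x ^+ 2. Proof. exact: sqr_ge0. Qed.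

Let mf2 : measurable_fun [set: V] (fun x => f x ^+ 2).
Proof. by apply: measurable_funX; exact: f2.1. Qed.

Lemma square_integrable_mix u :
  square_integrable (mu \x mu)%E (fun z => f (mix u z.1 z.2)).
Proof.
split; first by apply: measurable_fun_mix; exact: f2.1.
have mf2m : measurable_fun [set: V * V] (fun z => (f (mix u z.1 z.2) ^+ 2)%:E).
  by apply/measurable_EFinP; exact: (measurable_fun_mix u mf2).
have f2m0 (z : V * V) : (0 <= (f (mix u z.1 z.2) ^+ 2)%:E)%E by rewrite lee_fin.
rewrite (fubini_tonelli1 (m1 := mu) (m2 := mu) _ mf2m f2m0).
by rewrite /fubini_F -(ge0_integral_mix u mf2)// f2.2.
Qed.

Lemma measurable_mix_section u x : measurable_fun [set: V] (fun y => f (mix u x y)).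
Proof.
have := measurable_fun_mix u f2.1.
exact: (@measurable_fun_pair2 _ _ _ V V _ (fun z : V * V => f (mix u z.1 z.2)) x).
Qed.

Lemma marginal_sqr_le u x :
  ((marginal u x ^+ 2)%:E <= \int[mu]_y (f (mix u x y) ^+ 2)%:E)%E.
Proof.
have [fin|] := ltP (\int[mu]_y (f (mix u x y) ^+ 2)%:E)%E +oo%E; last first.
  by rewrite leye_eq => /eqP ->; rewrite leey.
by apply: jensen_sqr; split => //; exact: measurable_mix_section.
Qed.

Lemma square_integrable_fst (psi : V -> R) : square_integrable mu psi ->
  square_integrable (mu \x mu)%E (fun z => psi z.1).
Proof.
move=> [mpsi psi2]; have mpsi1 : measurable_fun [set: V * V] (fun z => psi z.1).
  exact: (measurableT_comp mpsi measurable_fst).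
have mpsi2 : measurable_fun [set: V * V] (fun z => (psi z.1 ^+ 2)%:E).
  by apply/measurable_EFinP; exact: measurable_funX.
have psi20 (z : V * V) : (0 <= (psi z.1 ^+ 2)%:E)%E by rewrite lee_fin sqr_ge0.
split => //; rewrite (fubini_tonelli1 (m1 := mu) (m2 := mu) _ mpsi2 psi20).
apply: le_lt_trans psi2; rewrite le_eqVlt; apply/orP; left; apply/eqP.
apply: eq_integral => x _; rewrite /fubini_F/=.
by rewrite integral_cst//= probability_setT mule1.
Qed.

Let integrable_mix u : (mu \x mu)%E.-integrable setT (fun z => (f (mix u z.1 z.2))%:E).
Proof.
have c2 := square_integrable_fst (square_integrable_cst mu 1).
have := square_integrableM (square_integrable_mix u) c2.
rewrite (_ : EFin \o _ = (fun z => (f (mix u z.1 z.2))%:E))//.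
by apply/funext => z /=; rewrite mulr1.
Qed.

Lemma square_integrable_marginal u : square_integrable mu (marginal u).
Proof.
have mm : measurable_fun [set: V] (marginal u).
  apply: measurableT_comp; first exact: fine_measurable.
  exact: (measurable_fubini_F (integrable_mix u)).
split => //; apply: le_lt_trans f2.2; rewrite (ge0_integral_mix u mf2)//.
apply: ge0_le_integral => //.
- by move=> x _; rewrite lee_fin sqr_ge0.
- by apply/measurable_EFinP; exact: measurable_funX.
- have mf2m : measurable_fun [set: V * V] (fun z => (f (mix u z.1 z.2) ^+ 2)%:E).
    by apply/measurable_EFinP; exact: (measurable_fun_mix u mf2).
  apply: (measurable_fun_fubini_tonelli_F (m2 := mu) _ mf2m) => z.
  by rewrite lee_fin.
- by move=> x _; exact: marginal_sqr_le.
Qed.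

Lemma integral_marginalM u (psi : V -> R) : square_integrable mu psi ->
  (\int[mu]_x (marginal u x * psi x)%:E =
   \int[mu \x mu]_z (f (mix u z.1 z.2) * psi z.1)%:E)%E.
Proof.
move=> psi2.
have iM := square_integrableM (square_integrable_mix u) (square_integrable_fst psi2).
rewrite -[RHS](integral12_prod_meas1 iM); apply: ae_eq_integral => //.
- apply/measurable_EFinP; apply: measurable_funM; last exact: psi2.1.
  exact: (square_integrable_marginal u).1.
- exact: (measurable_fubini_F iM).
(* For almost every [x] the section is integrable and [fine] in [marginal] returns the true
   integral. *)
have := ae_integrable1 (integrable_mix u).
apply: filterS => x /= ix _.
have Ifin : (\int[mu]_y (f (mix u x y))%:E)%E \is a fin_num by exact: integrable_fin_num.
rewrite /fubini_F/= EFinM /marginal fineK//.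
under [RHS]eq_integral do rewrite EFinM.
by rewrite integralZr.
Qed.

(* Exchange the coordinates in u but not in w: psi is unaffected. *)
Lemma integral_marginal_cap u w (psi : V -> R) : square_integrable mu psi ->
  (forall x y, psi (mix w x y) = psi x) ->
  (\int[mu]_x (marginal u x * psi x)%:E =
   \int[mu]_x (marginal (u :&: w)%SET x * psi x)%:E)%E.
Proof.
move=> psi2 psi_w; rewrite !integral_marginalM//.
pose k := (~: (u :\: w))%SET.
pose F (z : V * V) := (f (mix u z.1 z.2) * psi z.1)%:E.
have iM v := square_integrableM (square_integrable_mix v) (square_integrable_fst psi2).
(* After the swap, the coordinates in [u] but not in [w] come from the second copy, so [f] retains
   those in both. As [k] contains [w], the argument of [psi] is unchanged on [w]. *)
have Fswap z : F (swap k z) = (f (mix (u :&: w)%SET z.1 z.2) * psi z.1)%:E.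
  case: z => x y; rewrite /F/=; congr (f _ * _)%:E.
    by apply/rowP => i; rewrite !mxE !inE; case: (i \in u); case: (i \in w).
  rewrite -(psi_w x (mix k x y)); congr psi.
  by apply/rowP => i; rewrite !mxE !inE; case: (i \in u); case: (i \in w).
under [RHS]eq_integral do rewrite -Fswap.
rewrite -[LHS]/(\int[mu \x mu]_z F z)%E; apply/esym/(integral_swap indep).
  exact: (measurable_int _ (iM u)).
rewrite (_ : F \o _ = fun z => (f (mix (u :&: w)%SET z.1 z.2) * psi z.1)%:E).
  exact: iM.
by apply/funext => z; exact: Fswap.
Qed.

End marginal.

(** * The Hoeffding decomposition *)

Lemma partial_slice (R : realType) (d : nat) (f : 'rV[R]_d -> R) (j : 'I_d)
    (x : 'rV[R]_d) : (forall y, differentiable f y) ->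
  let q t := f (\row_i (if i == j then t else x 0 i)) in
  forall t, derivable q t 1 /\
    q^`()%classic t = partial f j (\row_i (if i == j then t else x 0 i)).
Proof.
move=> df q t; set y := \row_i _.
have qE (h : R) : q (h *: 1 + t) = f (h *: delta_mx 0 j + y).
  congr f; apply/rowP => i; rewrite !mxE eqxx/= [h *: 1]mulr1.
  by case: eqP => _; rewrite ?mulr1// mulr0 add0r.
have dqE : (fun h : R => h^-1 *: (q (h *: 1 + t) - q t)) =
    (fun h : R => h^-1 *: (f (h *: delta_mx 0 j + y) - f y)).
  by apply/funext => h; rewrite qE.
have := @diff_derivable _ _ _ f y (delta_mx 0 j) (df y).
rewrite derive1E /partial /derivable /derive /=.
by rewrite -dqE.
Qed.

Section law.
Context (disp : measure_display) (T : measurableType disp) (R : realType)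
  (P : probability T R) (d : nat) (X : 'I_d -> {RV P >-> R}).
Local Notation V := (row_space R d).

Lemma measurable_random_vector :
  measurable_fun [set: T] (random_vector X : T -> V).
Proof.
apply: measurable_row => i.
rewrite (_ : (fun w => _) = X i); first exact: measurable_funPT.
by apply/funext => w; rewrite mxE.
Qed.

Definition random_row : {mfun T >-> V} := mfun_Sub (mem_set measurable_random_vector).

Definition law : probability V R := distribution P random_row.

Lemma ge0_integral_law (g : V -> \bar R) : measurable_fun [set: V] g ->
  (forall x, (0 <= g x)%E) ->
  (\int[law]_x g x = \int[P]_w g (random_vector X w))%E.
Proof. exact: ge0_integral_distribution. Qed.

Lemma ge0_integral_law_coord (j : 'I_d) (phi : R -> \bar R) : measurable_fun [set: R] phi ->
  (forall t, (0 <= phi t)%E) ->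
  (\int[law]_x phi ((x : 'rV[R]_d) 0%R j) = \int[distribution P (X j)]_t phi t)%E.
Proof.
move=> mphi phi0; rewrite ge0_integral_distribution//.
rewrite ge0_integral_law//; last exact: (measurableT_comp mphi (measurable_coord j)).
by apply: eq_integral => w _; rewrite /= mxE.
Qed.

Lemma law_independent_coordinates : mutually_independent X ->
  independent_coordinates law.
Proof.
move=> indep; exists (fun i A => P (X i @^-1` A)) => A mA.
transitivity (P (\bigcap_(i in [set` [set: 'I_d]%SET]) X i @^-1` A i)).
  congr (P _); apply/seteqP; split=> w h i.
    by move=> _; have := h i; rewrite /= mxE.
  by have := h i; rewrite /= mxE; apply; rewrite finset.in_setT.
by rewrite indep//; apply: eq_bigl => i; rewrite finset.in_setT.
Qed.

(** The one-dimensional inequality on each slice, integrated over the other coordinates. The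
    marginal term stands on the right to avoid a subtraction of extended reals. *)
Lemma integral_sqr_le_marginal (f : 'rV[R]_d -> R) (j : 'I_d) (rho : R -> R) :
  mutually_independent X -> boltzmann_density (distribution P (X j)) rho ->
  (forall x, differentiable f x) -> square_integrable law (f : V -> R) ->
  (\int[law]_x (f x ^+ 2)%:E <=
   \int[law]_x (marginal law f (~: [set j])%SET x ^+ 2)%:E +
   (4%:E * cheeger_constant (X j) rho ^+ 2) * \int[law]_x (partial f j x ^+ 2)%:E)%E.
Proof.
move=> indep rhoP df f2; have indepL := law_independent_coordinates indep.
set u := (~: [set j])%SET.
have mixI := ge0_integral_mix indepL u.
set C := cheeger_constant _ _.
have C0 : (0 <= 4%:E * C ^+ 2)%E.
  have C0 : (0 <= C)%E.
    case: (rhoP) => [[v [c [_ c0 rhoE]]] _]; apply: cheeger_constant_ge0 => t.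
    by rewrite rhoE mulr_gt0// expR_gt0.
  by rewrite mule_ge0// expe2 mule_ge0.
have [m poincare] := cheeger_poincare rhoP.
have mf : measurable_fun [set: V] (f : V -> R) := f2.1.
have mfsq : measurable_fun [set: V] (fun x => f x ^+ 2) by exact: measurable_funX.
have mp : measurable_fun [set: V] (partial f j : V -> R) by exact: measurable_partial.
have mpsq : measurable_fun [set: V] (fun x => partial f j x ^+ 2) by exact: measurable_funX.
have mq2 (g : V -> R) : measurable_fun [set: V] g -> (forall x, 0 <= g x) ->
    measurable_fun [set: V] (fun x => \int[law]_y (g (mix u x y))%:E)%E.
  move=> mg g0.
  have mgm : measurable_fun [set: V * V] (fun z => (g (mix u z.1 z.2))%:E).
    by apply/measurable_EFinP; exact: measurable_fun_mix.
  by apply: (measurable_fun_fubini_tonelli_F (m2 := law) _ mgm) => z; rewrite lee_fin.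
have mm : measurable_fun [set: V] (fun x => (marginal law f u x ^+ 2)%:E).
  by apply/measurable_EFinP/measurable_funX; exact: (square_integrable_marginal indepL f2 u).1.
have f2int : (\int[law]_x \int[law]_y (f (mix u x y) ^+ 2)%:E < +oo)%E.
  by rewrite -(mixI _ mfsq) ?f2.2// => x; exact: sqr_ge0.
rewrite (mixI _ mfsq); last by move=> x; exact: sqr_ge0.
rewrite (mixI _ mpsq); last by move=> x; exact: sqr_ge0.
have part0 x : (0 <= \int[law]_y (partial f j (mix u x y) ^+ 2)%:E)%E.
  by apply: integral_ge0 => y _; rewrite lee_fin sqr_ge0.
have mpart : measurable_fun [set: V] (fun x => \int[law]_y (partial f j (mix u x y) ^+ 2)%:E)%E.
  by apply: (mq2 (fun x => partial f j x ^+ 2)) => // x; exact: sqr_ge0.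
rewrite -ge0_integralZl// -ge0_integralD//; last 3 first.
- by move=> x _; rewrite lee_fin sqr_ge0.
- by move=> x _; rewrite mule_ge0.
- exact: emeasurable_funM.
have msq : measurable_fun [set: V] (fun x => \int[law]_y (f (mix u x y) ^+ 2)%:E)%E.
  by apply: (mq2 (fun x => f x ^+ 2)) => // x; exact: sqr_ge0.
apply: ae_ge0_le_integral => //.
- by move=> x _; apply: integral_ge0 => y _; rewrite lee_fin sqr_ge0.
- by move=> x _; apply: adde_ge0; [rewrite lee_fin sqr_ge0|exact: mule_ge0].
- by apply: emeasurable_funD => //; exact: emeasurable_funM.
(* Almost every slice is square integrable; only these are admissible for [poincare]. *)
have fin_ae : {ae law, forall x, (\int[law]_y (f (mix u x y) ^+ 2)%:E < +oo)%E}.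
  have : law.-integrable setT (fun x => \int[law]_y (f (mix u x y) ^+ 2)%:E)%E.
    apply/integrableP; split => //.
    rewrite (eq_integral (fun x : V => \int[law]_y (f (mix u x y) ^+ 2)%:E)%E)// => x _.
    by rewrite gee0_abs//; apply: integral_ge0 => y _; rewrite lee_fin sqr_ge0.
  move=> /integrable_ae => /(_ measurableT); apply: filterS => x /= /(_ I) h.
  by rewrite ltey_eq h.
apply: (@filterS _ _ (ae_filter_ringOfSetsType law) _ _ _ fin_ae) => x /= xfin _.
pose q t := f (\row_i (if i == j then t else x 0 i)).
(* With [u] the complement of [j], the section depends on [y] through its coordinate [j] alone, so
   its integrals are taken against the law of [X j]. *)
have mixE (y : V) : mix u x y = \row_i (if i == j then (y : 'rV[R]_d) 0%R j else x 0 i).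
  by apply/rowP => i; rewrite !mxE !inE; case: (eqVneq i j) => //= ->.
have [dq q'E] : (forall t, derivable q t 1) /\ (forall t, q^`()%classic t =
    partial f j (\row_i (if i == j then t else x 0 i))).
  by split=> t; have [] := partial_slice j x df t.
have fx2 : square_integrable law (fun y => f (mix u x y)).
  by split => //; exact: (measurable_mix_section f2 u x).
apply: (le_trans (integral_sqr_le_sub (q m) fx2)).
rewrite leeD2l//.
have mq : measurable_fun [set: R] (fun t => ((q t - q m) ^+ 2)%:E).
  apply/measurable_EFinP/measurable_funX; apply: measurable_funB => //.
  apply: continuous_measurable_fun => t.
  by apply: differentiable_continuous; exact/derivable1_diffP.
have mq' : measurable_fun [set: R] (fun t => (q^`()%classic t ^+ 2)%:E).
  by apply/measurable_EFinP/measurable_funX; exact: measurable_derive1.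
have -> : (\int[law]_y ((f (mix u x y) - q m) ^+ 2)%:E =
    \int[distribution P (X j)]_t ((q t - q m) ^+ 2)%:E)%E.
  rewrite -(ge0_integral_law_coord j mq); last by move=> t; rewrite lee_fin sqr_ge0.
  by apply: eq_integral => y _; rewrite mixE.
have -> : (\int[law]_y (partial f j (mix u x y) ^+ 2)%:E =
    \int[distribution P (X j)]_t (q^`()%classic t ^+ 2)%:E)%E.
  rewrite -(ge0_integral_law_coord j mq'); last by move=> t; rewrite lee_fin sqr_ge0.
  by apply: eq_integral => y _; rewrite mixE q'E.
apply: (poincare q dq).
rewrite -(ge0_integral_law_coord j mq); last by move=> t; rewrite lee_fin sqr_ge0.
have := square_integrableD fx2 (square_integrable_cst law (- q m)) => -[_].
apply: le_lt_trans; rewrite le_eqVlt; apply/orP; left; apply/eqP.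
by apply: eq_integral => y _; rewrite mixE.
Qed.

End law.

(** * Identifying all versions of the conditional expectation *)

Section conditional_expectation.
Context (disp : measure_display) (T : measurableType disp) (R : realType)
  (P : probability T R) (d : nat) (X : 'I_d -> {RV P >-> R}).
Hypothesis indep : mutually_independent X.
Context (f : 'rV[R]_d -> R) (f2 : square_integrable (law X) (f : row_space R d -> R)).
Local Notation V := (row_space R d).
Local Notation mu := (law X).
Local Notation XV := (random_vector X : T -> V).

Let indepL := law_independent_coordinates indep.

Lemma square_integrable_law (g : V -> R) : square_integrable mu g ->
  square_integrable P (fun w => g (random_vector X w)).
Proof.
move=> [mg g2]; split.
  exact: (measurableT_comp mg (measurable_random_vector X)).
move: g2; rewrite ge0_integral_law//.
- by apply/measurable_EFinP; exact: measurable_funX.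
- by move=> x; rewrite lee_fin sqr_ge0.
Qed.

Lemma integral_law (g : V -> R) : measurable_fun [set: V] g ->
  P.-integrable setT (fun w => (g (random_vector X w))%:E) ->
  (\int[mu]_x (g x)%:E = \int[P]_w (g (random_vector X w))%:E)%E.
Proof.
move=> mg ig; apply: integral_distribution => //; exact/measurable_EFinP.
Qed.

(** The preimages of measurable sets that ignore the coordinates outside [u] form a sigma-algebra
    containing the generators. *)
Lemma coordinate_events_invariant u (A : set T) : <<s coordinate_events X u >> A ->
  exists B : set V, [/\ measurable B,
    (forall x y, B (mix u x y) <-> B x) & A = XV @^-1` B].
Proof.
move: A; apply: smallest_sub; last first.
  move=> A [i /= iu [B mB <-]]; rewrite setTI.
  exists ((fun x : V => (x : 'rV[R]_d) 0 i) @^-1` B); split.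
  - by rewrite -[X in measurable X]setTI; exact: measurable_coord.
  - by move=> x y /=; rewrite mxE iu.
  - by apply/seteqP; split=> w /=; rewrite mxE.
split.
- by exists set0; split => //; rewrite preimage_set0.
- move=> A [B [mB Bu ->]]; exists (~` B); split; first exact: measurableC.
    by move=> x y /=; have [h1 h2] := Bu x y; split; exact: contra_not.
  by rewrite setTD preimage_setC.
- move=> F /choice[B hB]; exists (\bigcup_n B n); split.
  + by apply: bigcup_measurable => n _; case: (hB n).
  + by move=> x y; split=> -[n _ Bn]; exists n => //;
      case: (hB n) => _ /(_ x y) [h1 h2] _; [exact: h1|exact: h2].
  + by rewrite preimage_bigcup; apply: eq_bigcupr => n _; case: (hB n).
Qed.

Lemma measurable_coordinate_marginal u :
  measurable_fun [set: g_sigma_algebraType (coordinate_events X u)]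
    (fun w => marginal mu f u (random_vector X w)).
Proof.
(* Setting the coordinates outside [u] to 0 leaves the marginal unchanged and makes its argument
   measurable for the sigma-algebra of [X_u]. *)
rewrite (_ : (fun w => _) = (fun w => marginal mu f u (mix u (random_vector X w) 0))); last first.
  by apply/funext => w; apply: marginal_local => i iu; rewrite [RHS]mxE iu.
apply: (measurableT_comp (square_integrable_marginal indepL f2 u).1).
apply: measurable_row => i.
rewrite (_ : (fun w => _) = if i \in u then (X i : T -> R) else cst 0); last first.
  by apply/funext => w; rewrite mxE; case: ifP => _; rewrite mxE.
case: ifPn => [iu|_]; last exact: measurable_cst.
move=> _ A mA; rewrite setTI; apply: sub_sigma_algebra; exists i => //.
by exists A => //; rewrite setTI.
Qed.

(** Uniqueness of conditional expectation: both functions are measurable for the sigma-algebra of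
    [X_u] and have the same integral over each of its events. *)
Lemma cond_expectation_marginal u (g : T -> R) :
  cond_expectation P (coordinate_events X u) (fun w => f (random_vector X w)) g ->
  measurable_fun [set: T] g /\
  {ae P, forall w, g w = marginal mu f u (random_vector X w)}.
Proof.
set G := coordinate_events X u => -[mg ig gE].
have GT A : <<s G >> A -> measurable A.
  move=> /coordinate_events_invariant[B [mB _ ->]].
  by rewrite -[X in measurable X]setTI; exact: measurable_random_vector.
have mid : measurable_fun [set: T] (idfun : T -> g_sigma_algebraType G).
  by move=> _ A mA; rewrite setTI; exact: GT.
split; first exact: (measurableT_comp mg mid).
pose h w := marginal mu f u (random_vector X w).
have h2 : square_integrable P h.
  exact: (square_integrable_law (square_integrable_marginal indepL f2 u)).
have hi := square_integrable_integrable h2.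
have [m [mE mint]] := pushforward_measure_integral P mid.
have mgE : measurable_fun [set: g_sigma_algebraType G] (EFin \o (g : g_sigma_algebraType G -> R)).
  exact/measurable_EFinP.
have mhE : measurable_fun [set: g_sigma_algebraType G] (EFin \o (h : g_sigma_algebraType G -> R)).
  by apply/measurable_EFinP; exact: measurable_coordinate_marginal.
(* m is the restriction of P to the sigma-algebra generated by G. *)
have : ae_eq m setT (EFin \o (g : g_sigma_algebraType G -> R)) (EFin \o h).
  apply: integral_ae_eq => //.
    by have [] := mint setT _ measurableT mgE ig.
  move=> E _ mE'; have mET := GT E mE'.
  have [_ ->] := mint E _ mE' mgE (integrableS measurableT mET (@subsetT _ _) ig).
  have [_ ->] := mint E _ mE' mhE (integrableS measurableT mET (@subsetT _ _) hi).
  rewrite /= gE//.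
  have [B [mB Bu EB]] := coordinate_events_invariant mE'.
  have B2 : square_integrable mu (\1_B : V -> R).
    split; first exact: measurable_indic.
    rewrite (eq_integral (fun x => (\1_B x)%:E)); last first.
      by move=> x _; rewrite indicE; case: (x \in B); rewrite ?expr1n// expr0n.
    by rewrite integral_indic// setIT (le_lt_trans (probability_le1 _ mB))// ltry.
  have restr (k : V -> R) : square_integrable mu k ->
      (\int[P]_(w in E) (k (random_vector X w))%:E = \int[mu]_x (k x * \1_B x)%:E)%E.
    move=> k2; have kB := square_integrableM k2 B2.
    have mkB : measurable_fun [set: V] (fun x => k x * \1_B x).
      by apply: measurable_funM; [exact: k2.1|exact: B2.1].
    rewrite integral_law//; last first.
      exact: (square_integrableM (square_integrable_law k2) (square_integrable_law B2)).
    rewrite integral_mkcond; apply: eq_integral => w _.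
    rewrite patchE EB indicE /=.
    have -> : (w \in XV @^-1` B) = (random_vector X w \in B) by apply/idP/idP; rewrite !inE.
    by case: ifP => _; rewrite ?mulr1// mulr0.
  rewrite (restr _ f2) (restr _ (square_integrable_marginal indepL f2 u)).
  have Bmix x y : (\1_B (mix u x y) : R) = \1_B x.
    rewrite !indicE; have [Bx Bm] := Bu x y.
    by have -> : (mix u x y \in B) = (x \in B) by apply/idP/idP; rewrite !inE.
  (* The exchange identity between the full set, whose marginal is [f], and [u], tested on an
     indicator that ignores the coordinates outside [u]. *)
  have := integral_marginal_cap indepL f2 [set: 'I_d]%SET B2 Bmix.
  rewrite finset.setTI => <-.
  by apply: eq_integral => x _; rewrite marginalT.
move=> [N [mN mN0 sub]]; exists N; split.
- exact: GT.
- by rewrite -mE.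
- move=> w nw; apply: sub => /=; apply: contra_not nw => /(_ I) [].
  by [].
Qed.

End conditional_expectation.

Lemma square_integrable_ae_eq d (T : measurableType d) (R : realType)
    (mu : {measure set T -> \bar R}) (g h : T -> R) :
  measurable_fun [set: T] g -> {ae mu, forall x, g x = h x} ->
  square_integrable mu h -> square_integrable mu g.
Proof.
move=> mg gh [mh h2]; split => //; rewrite (ae_eq_integral (fun x => (h x ^+ 2)%:E))//.
- by apply/measurable_EFinP; exact: measurable_funX.
- by apply/measurable_EFinP; exact: measurable_funX.
- by apply: filterS gh => x /= -> _.
Qed.

Lemma inner_product_ae_eq d (T : measurableType d) (R : realType)
    (mu : {measure set T -> \bar R}) (g g' h h' : T -> R) :
  square_integrable mu g -> square_integrable mu g' ->
  square_integrable mu h -> square_integrable mu h' ->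
  {ae mu, forall x, g x = g' x} -> {ae mu, forall x, h x = h' x} ->
  inner_product mu g h = inner_product mu g' h'.
Proof.
move=> [mg _] [mg' _] [mh _] [mh' _] gg' hh'; congr fine; apply: ae_eq_integral => //.
- by apply/measurable_EFinP; exact: measurable_funM.
- by apply/measurable_EFinP; exact: measurable_funM.
- by apply: filterS2 gg' hh' => x /= -> -> _.
Qed.

Lemma inner_productE d (T : measurableType d) (R : realType)
    (mu : {measure set T -> \bar R}) (g : T -> R) : square_integrable mu g ->
  (\int[mu]_x (g x ^+ 2)%:E = (inner_product mu g g)%:E)%E.
Proof.
move=> g2; rewrite /inner_product fineK//.
exact: integrable_fin_num (square_integrableM g2 g2).
Qed.

(** * Orthogonality of the components and the total index *)

Section hoeffding.
Context (disp : measure_display) (T : measurableType disp) (R : realType)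
  (P : probability T R) (d : nat) (X : 'I_d -> {RV P >-> R}).
Hypothesis indep : mutually_independent X.
Context (f : 'rV[R]_d -> R) (f2 : square_integrable (law X) (f : row_space R d -> R)).
Context (F : {set 'I_d} -> T -> R)
  (hF : hoeffding_components X (fun w => f (random_vector X w)) F).
Local Notation mu := (law X).
Implicit Types u : {set 'I_d}.

Let indepL := law_independent_coordinates indep.

Let partial_sum u : T -> R := fun w => \sum_(v : {set 'I_d} | v \subset u) F v w.

Let partial_sumE u w :
  partial_sum u w = F u w + \sum_(v : {set 'I_d} | v \proper u) F v w.
Proof.
rewrite /partial_sum (bigD1 u)//=; congr (_ + _); apply: eq_bigl => v.
by rewrite finset.properEneq andbC.
Qed.

Let f2P := square_integrable_law f2.

(** The recursion telescopes: summing over the subsets of [u] returns the very version chosen at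
    [u], whatever versions were chosen below. *)
Lemma hoeffding_partial_sum u : measurable_fun [set: T] (partial_sum u) /\
  {ae P, forall w, partial_sum u w = marginal mu f u (random_vector X w)}.
Proof.
have [F0 Fu] := hF; have [->|u0] := eqVneq u finset.set0; last first.
  have [g gce gE] := Fu u u0.
  rewrite (_ : partial_sum u = g); first exact: cond_expectation_marginal gce.
  by apply/funext => w; rewrite partial_sumE gE subrK.
have sumE w : partial_sum finset.set0 w = fine 'E_P[fun w => f (random_vector X w)]%E.
  rewrite partial_sumE big_pred0 ?addr0; first by rewrite -(F0 w).
  by move=> v; rewrite properE finset.sub0set andbF.
split.
  rewrite (_ : partial_sum _ = cst (fine 'E_P[fun w => f (random_vector X w)]%E))//;
    last exact/funext.
apply: aeW => w; rewrite sumE unlock; congr fine.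
rewrite -(@integral_law _ _ _ P _ X f f2.1); last exact: (square_integrable_integrable f2P).
apply: eq_integral => x _; congr (f _)%:E.
by apply/rowP => i; rewrite mxE finset.in_set0.
Qed.

Let square_integrable_partial_sum u : square_integrable P (partial_sum u).
Proof.
have [mS SE] := hoeffding_partial_sum u.
apply: square_integrable_ae_eq SE _ => //.
exact: (square_integrable_law (square_integrable_marginal indepL f2 u)).
Qed.

Lemma square_integrable_hoeffding u : square_integrable P (F u).
Proof.
have [n] := ubnP #|u|; elim: n u => // n IH u un.
rewrite (_ : F u = fun w => partial_sum u w + - \sum_(v : {set 'I_d} | v \proper u) F v w).
  apply: square_integrableD; first exact: square_integrable_partial_sum.
  apply/square_integrableN/square_integrable_sum => v vu; apply: IH.
  by rewrite (leq_trans (proper_card vu)).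
by apply/funext => w; rewrite partial_sumE addrK.
Qed.

(** The left side is the double sum [S u w] of the combinatorial section, for the Gram matrix of the
    components. *)
Let inner_product_partial_sum (u w : {set 'I_d}) :
  \sum_(v : {set 'I_d} | v \subset u) \sum_(z : {set 'I_d} | z \subset w)
    inner_product P (F v) (F z) =
  inner_product mu (marginal mu f u) (marginal mu f w).
Proof.
transitivity (inner_product P (partial_sum u) (partial_sum w)).
  rewrite inner_product_suml//; last by move=> v _; exact: square_integrable_hoeffding.
  apply: eq_bigr => v _; rewrite inner_productC inner_product_suml//.
  - by apply: eq_bigr => z _; rewrite inner_productC.
  - by move=> z _; exact: square_integrable_hoeffding.
  - exact: square_integrable_hoeffding.
have mu2 v := square_integrable_marginal indepL f2 v.
rewrite (inner_product_ae_eq _ (square_integrable_law (mu2 u)) _ (square_integrable_law (mu2 w))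
  (hoeffding_partial_sum u).2 (hoeffding_partial_sum w).2)//.
congr fine; rewrite (@integral_law _ _ _ P _ X (fun x => marginal mu f u x * marginal mu f w x))//.
- by apply: measurable_funM; [exact: (mu2 u).1|exact: (mu2 w).1].
- exact: (square_integrableM (square_integrable_law (mu2 u)) (square_integrable_law (mu2 w))).
Qed.

Lemma total_sobolE j : total_sobol P F j =
  (inner_product mu f f - inner_product mu (marginal mu f (~: [set j])%SET)
    (marginal mu f (~: [set j])%SET))%:E.
Proof.
rewrite /total_sobol.
transitivity (\sum_(v : {set 'I_d} | j \in v) (inner_product P (F v) (F v))%:E)%E.
  apply: eq_bigr => v _; rewrite unlock -inner_productE//.
  exact: square_integrable_hoeffding.
rewrite sumEFin (@sum_diag_containing _ _ (fun u v => inner_product P (F u) (F v))).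
- rewrite !inner_product_partial_sum; congr (_ - _)%:E.
  by congr fine; apply: eq_integral => x _; rewrite marginalT.
- by move=> u v; exact: inner_productC.
(* [S_cap] holds because the marginal on [w] ignores the coordinates outside [w]. *)
- move=> u w; rewrite !inner_product_partial_sum; congr fine.
  apply: (integral_marginal_cap indepL f2 u (square_integrable_marginal indepL f2 w)) => x y.
  by apply: marginal_local => i iw; rewrite mxE iw.
Qed.

End hoeffding.

Theorem theorem3p1 (R : realType) (disp : measure_display)
    (T : measurableType disp) (P : probability T R)
    (d : nat) (X : 'I_d -> {RV P >-> R}) (f : 'rV[R]_d -> R) (j : 'I_d)
    (rho : R -> R) (F : {set 'I_d} -> T -> R)
    (hd : (1 <= d)%N)
    (hf : forall x : 'rV[R]_d, differentiable f x)
    (A1 : mutually_independent X)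
    (A2 : ('E_P[fun w => (f (random_vector X w) ^+ 2)%R] < +oo)%E)
    (A3 : (dgsm X f j < +oo)%E)
    (A4 : boltzmann_density (distribution P (X j)) rho)
    (hF : hoeffding_components X (fun w => f (random_vector X w)) F) :
  (total_sobol P F j
     <= (4%:E * cheeger_constant (X j) rho ^+ 2) * dgsm X f j)%E.
Proof.
have mf : measurable_fun [set: row_space R d] (f : row_space R d -> R).
  by apply: continuous_measurable_row => x; exact: differentiable_continuous.
have f2 : square_integrable (law X) (f : row_space R d -> R).
  split => //; move: A2; rewrite unlock ge0_integral_law//.
  - by apply/measurable_EFinP; exact: measurable_funX.
  - by move=> x; rewrite lee_fin sqr_ge0.
(* The subtracted inner product is a real number, so it may move to the right side of an inequality
   in the extended reals. *)
rewrite (total_sobolE A1 f2 hF) EFinB leeBlDl//.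
rewrite -(inner_productE f2).
rewrite -(inner_productE (square_integrable_marginal (law_independent_coordinates A1) f2 _)).
apply: (le_trans (integral_sqr_le_marginal A1 A4 hf f2)).
rewrite leeD2l// /dgsm unlock ge0_integral_law//.
- by apply/measurable_EFinP/measurable_funX; exact: measurable_partial.
- by move=> x; rewrite lee_fin sqr_ge0.
Qed.
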